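(* Let $n\geq 2$, $p,q>1$ and $c>0$ be real with $\Gamma_{SS}(p,q,n)>0$, where $$\Gamma_{SS}(p,q,n):=\max\Big\{\frac{p+2+q^{-1}}{pq-1},\ \frac{q+2+p^{-1}}{pq-1}\Big\}-\frac{n-1}{2}.$$ Let $(\mathbb{R}^n,\mathfrak{g})$ be an asymptotically Euclidean manifold (as defined in the context), and consider the Cauchy problem $$\begin{cases}\partial_t^2u-c^2\Delta_{\mathfrak{g}}u=|v|^p, & (t,x)\in(0,T)\times\mathbb{R}^n,\\ \partial_t^2v-\Delta_{\mathfrak{g}}v=|u|^q, & (t,x)\in(0,T)\times\mathbb{R}^n,\\ u(0,x)=\varepsilon u_0(x),\quad u_t(0,x)=\varepsilon u_1(x),\\ v(0,x)=\varepsilon v_0(x),\quad v_t(0,x)=\varepsilon v_1(x),\end{cases}$$ where $u_0,u_1,v_0,v_1\in C_c^\infty(\mathbb{R}^n)$, both $(u_0,u_1)$ and $(v_0,v_1)$ are nontrivial, nonnegative and supported in $B_R=\{x\in\mathbb{R}^n:|x|\le R\}$ for some $R>0$, and the data satisfy, for $i=0,1$, $$\int_{\mathbb{R}^n}u_i\,dv_{\mathfrak{g}}>0,\quad \int_{\mathbb{R}^n}u_0\phi_\lambda\,dv_{\mathfrak{g}}>0,\quad \int_{\mathbb{R}^n}(u_1-c\lambda u_0)\phi_\lambda\,dv_{\mathfrak{g}}>0,$$ $$\int_{\mathbb{R}^n}v_i\,dv_{\mathfrak{g}}>0,\quad \int_{\mathbb{R}^n}v_0\phi_\lambda\,dv_{\mathfrak{g}}>0,\quad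 \int_{\mathbb{R}^n}(v_1-\lambda v_0)\phi_\lambda\,dv_{\mathfrak{g}}>0.$$ Suppose the problem has a weak solution $u,v\in C^2([0,T_\varepsilon);\mathcal{D}'(\mathbb{R}^n))$ with $|v|^p,|u|^q\in C([0,T_\varepsilon);\mathcal{D}'(\mathbb{R}^n))$ and with $$\operatorname{supp}u\subset D_1:=\Big\{(t,x):\int_0^{|x|}K(\tau)\,d\tau\le ct+R_1\Big\},\qquad \operatorname{supp}v\subset D_2:=\Big\{(t,x):\int_0^{|x|}K(\tau)\,d\tau\le t+R_1\Big\}.$$ Then there exists a constant $\varepsilon_0>0$ such that for any $\varepsilon\in(0,\varepsilon_0)$ the solution blows up at finite time. Moreover, the lifespan satisfies $$T_\varepsilon\le C\,\varepsilon^{-\Gamma_{SS}(p,q,n)^{-1}}$$ with a constant $C>0$ independent of $\varepsilon\in(0,\varepsilon_0)$.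
   Context: Notation: $\langle r\rangle=\sqrt{1+r^2}$; $A\lesssim B$ means $A\le CB$ for some constant $C>0$; repeated indices are summed. Asymptotically Euclidean manifold: a Riemannian metric $\mathfrak{g}=g_{jk}(x)dx^jdx^k$ on $\mathbb{R}^n$ that decomposes as $\mathfrak{g}=\mathfrak{g}_1+\mathfrak{g}_2$, where: (i) in polar coordinates $x=r\omega$, $\mathfrak{g}_1=K^2(r)dr^2+r^2d\omega^2$, with $d\omega^2$ the standard metric on $\mathbb{S}^{n-1}$, and for some constant $\rho>0$, $|\partial_r^m(K-1)|\lesssim\langle r\rangle^{-m-\rho}$ for $m=0,1,2$; (ii) $\mathfrak{g}_2=g_{2,jk}(x)dx^jdx^k$ and for some $\beta>0$, $|\nabla g_{2,jk}|+|g_{2,jk}|\lesssim e^{-\beta\int_0^rK(\tau)d\tau}$ and $|\nabla^2g_{2,jk}|\lesssim1$ (with $r=|x|$); (iii) there is $\delta_0\in(0,1)$ with $\delta_0|\xi|^2\le g^{jk}\xi_j\xi_k\le\delta_0^{-1}|\xi|^2$ for all $\xi\in\mathbb{R}^n$, and $K\in(\delta_0,1/\delta_0)$, where $(g^{jk})$ is the inverse of $(g_{jk})$. $\Delta_{\mathfrak{g}}$ is the Laplace–Beltrami operator and $dv_{\mathfrak{g}}$ the Riemannian volume measure of $\mathfrak{g}$. The function $\phi_\lambda$: it is known (from earlier work) that there are $\lambda_0,c_0>0$ such that for every $0<\lambda\le\lambda_0$ there is a solution $\phi_\lambda$ on $\mathbb{R}^n$ of $\Delta_{\mathfrak{g}}\phi_\lambda=\lambda^2\phi_\lambda$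 with $c_0<\phi_\lambda(x)<c_0^{-1}\langle\lambda r\rangle^{-\frac{n-1}{2}}e^{\lambda\int_0^rK(\tau)d\tau}$, $r=|x|$. Here $\lambda\in(0,\lambda_0]$ and such a $\phi_\lambda$ are fixed. $R_1$ is a fixed constant, independent of $\varepsilon$, with $R_1\ge\int_0^{R}K(\tau)d\tau$. Weak solution means that the equations hold in the sense of distributions and the initial conditions are attained; $T_\varepsilon$ denotes the lifespan of the solution. *)

(* Defs.v *)
From HB Require Import structures.
From mathcomp Require Import all_boot all_order all_algebra.
From mathcomp Require Import all_classical all_reals all_analysis.

Set Implicit Arguments.
Unset Strict Implicit.
Unset Printing Implicit Defensive.

Import Order.TTheory GRing.Theory Num.Theory.
Import numFieldNormedType.Exports.

Local Open Scope classical_set_scope.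
Local Open Scope ring_scope.

Fact rV_measure_display : measure_display.
Proof. exact: default_measure_display. Qed.

(* Borel sets of R^n, as the sigma-algebra generated by the coordinates. *)
Section rV_measurable.
Context {R : realType} (n : nat).

Definition rV_coord (i : 'I_n) (x : 'rV[R]_n) : measurableTypeR R := x ord0 i.

Let rV_set0 : g_sigma_preimage rV_coord set0.
Proof. exact: sigma_algebra0. Qed.

Let rV_setC A : g_sigma_preimage rV_coord A -> g_sigma_preimage rV_coord (~` A).
Proof. exact: sigma_algebraC. Qed.

Let rV_bigcup (F : (set 'rV[R]_n)^nat) :
  (forall i, g_sigma_preimage rV_coord (F i)) ->
  g_sigma_preimage rV_coord (\bigcup_i (F i)).
Proof. exact: sigma_algebra_bigcup. Qed.

HB.instance Definition _ := @isMeasurable.Build rV_measure_display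
  'rV[R]_n (g_sigma_preimage rV_coord) rV_set0 rV_setC rV_bigcup.

End rV_measurable.

Section lebesgue_rV.
Context {R : realType}.
Local Open Scope ereal_scope.

Lemma measurable_rV_coord n (i : 'I_n) :
  measurable_fun [set: 'rV[R]_n] (@rV_coord R n i).
Proof.
move=> _ Y mY; rewrite setTI; apply: sub_sigma_algebra => /=.
rewrite -bigcup_seq/=; exists i => /=; first by rewrite mem_index_enum.
by exists Y => //; rewrite setTI.
Qed.

Lemma measurable_fun_rVP d (T : measurableType d) n (f : T -> 'rV[R]_n) :
  (forall i, measurable_fun [set: T] (@rV_coord R n i \o f)) ->
  measurable_fun [set: T] f.
Proof.
move=> mf _ A mA; rewrite setTI.
suff : g_sigma_preimage (@rV_coord R n) `<=` [set B | measurable (f @^-1` B)].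
  exact.
apply: smallest_sub => [|B].
  split => [|B mB|F mF] /=.
  - by rewrite preimage_set0.
  - by rewrite setTD preimage_setC; exact: measurableC.
  - by rewrite preimage_bigcup; exact: bigcupT_measurable.
rewrite -bigcup_seq/= => -[i _ [Y mY <-]] /=.
by rewrite setTI -comp_preimage -[X in measurable X]setTI; exact: mf.
Qed.

Definition rV_cons n (z : measurableTypeR R * 'rV[R]_n) : 'rV[R]_n.+1 :=
  row_mx (const_mx z.1 : 'rV[R]_1) z.2.

Lemma rV_cons0 n z : @rV_cons n z ord0 ord0 = z.1.
Proof.
have -> : (ord0 : 'I_n.+1) = lshift n (ord0 : 'I_1) by exact/val_inj.
by rewrite [LHS](row_mxEl (const_mx z.1 : 'rV[R]_1) z.2) mxE.
Qed.

Lemma rV_consS n z i : @rV_cons n z ord0 (lift ord0 i) = z.2 ord0 i.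
Proof.
have -> : (lift ord0 i : 'I_n.+1) = rshift 1 i by exact/val_inj.
exact: (row_mxEr (const_mx z.1 : 'rV[R]_1) z.2).
Qed.

Lemma measurable_rV_cons n :
  measurable_fun [set: (measurableTypeR R * 'rV[R]_n)%type] (@rV_cons n).
Proof.
apply: measurable_fun_rVP => i; have [->|[j ->]] : i = ord0 \/ exists j, i = lift ord0 j.
- by case: (unliftP ord0 i) => [j ->|->]; [right; exists j|left].
- rewrite (_ : _ \o _ = fst) //.
  by apply/funext => z; rewrite /= /rV_coord rV_cons0.
- rewrite (_ : _ \o _ = @rV_coord R n j \o snd).
    by apply: measurableT_comp => //; exact: measurable_rV_coord.
  by apply/funext => z; rewrite /= /rV_coord rV_consS.
Qed.

Section step.
Context n (mu : {sigma_finite_measure set 'rV[R]_n -> \bar R}).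

Definition lebesgue_rV_step :=
  pushforward (@lebesgue_measure R \x mu) (@rV_cons n).

Let step : {measure set 'rV[R]_n.+1 -> \bar R} :=
  measure_function_pushforward__canonical__measure_function_Measure
    (@lebesgue_measure R \x mu) (@measurable_rV_cons n).

Let step0 : lebesgue_rV_step set0 = 0.
Proof. exact: (measure0 step). Qed.

Let step_ge0 A : 0 <= lebesgue_rV_step A.
Proof. exact: (measure_ge0 step). Qed.

Let step_sigma_additive : semi_sigma_additive lebesgue_rV_step.
Proof. exact: (@measure_semi_sigma_additive _ _ _ step). Qed.

HB.instance Definition _ := isMeasure.Build _ _ _
  lebesgue_rV_step step0 step_ge0 step_sigma_additive.

Let sigma_finite_step : sigma_finite setT lebesgue_rV_step.
Proof.
have /sigma_finiteP[F [TF ndF mF]] := sigma_finiteT (@lebesgue_measure R).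
have /sigma_finiteP[G [TG ndG mG]] := sigma_finiteT mu.
pose uncons (x : 'rV[R]_n.+1) : measurableTypeR R * 'rV[R]_n :=
  (x ord0 ord0, \row_i x ord0 (lift ord0 i)).
have consK : cancel (@rV_cons n) uncons.
  move=> [a y]; congr pair; first by rewrite rV_cons0.
  by apply/rowP => i; rewrite mxE rV_consS.
have munc : measurable_fun setT uncons.
  apply/measurable_fun_pairP; split.
    exact: (@measurable_rV_coord n.+1 ord0).
  apply: measurable_fun_rVP => i.
  rewrite (_ : _ \o _ = @rV_coord R n.+1 (lift ord0 i)).
    exact: measurable_rV_coord.
  by apply/funext => x; rewrite /= /rV_coord mxE.
exists (fun k => uncons @^-1` (F k `*` G k)).
  rewrite -preimage_bigcup -(preimage_setT uncons); congr (_ @^-1` _).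
  rewrite -setXTT TF TG predeqE => -[x y]; split.
    move=> [/= [k _ Fkx] [l _ Gly]]; exists (maxn k l) => //; split.
    - by move: x Fkx; exact/subsetPset/ndF/leq_maxl.
    - by move: y Gly; exact/subsetPset/ndG/leq_maxr.
  by move=> [k _ []/= ? ?]; split; exists k.
move=> k; have [mFk Fk] := mF k; have [mGk Gk] := mG k; split.
  by rewrite -[X in measurable X]setTI; apply: munc => //; exact: measurableX.
rewrite /lebesgue_rV_step /pushforward -comp_preimage.
rewrite (_ : uncons \o _ = id) ?preimage_id; last exact/funext.
by rewrite product_measure1E// lte_mul_pinfty// ge0_fin_numE.
Qed.

HB.instance Definition _ := Measure_isSigmaFinite.Build _ _ _
  lebesgue_rV_step sigma_finite_step.

End step.

(* Lebesgue measure on R^n, as the n-fold product of the one on R. *)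
Fixpoint lebesgue_rV n : {sigma_finite_measure set 'rV[R]_n -> \bar R} :=
  match n with
  | 0%N => \d_(0%R : 'rV[R]_0)
  | m.+1 => lebesgue_rV_step (lebesgue_rV m)
  end.

End lebesgue_rV.

Section calculus.
Context {R : realType} {n : nat}.
Implicit Types (f psi : 'rV[R]_n -> R) (x : 'rV[R]_n).

(* The library norm on 'rV[R]_n is the sup norm. *)
Definition enorm x : R := Num.sqrt (\sum_i x ord0 i ^+ 2).

Definition japanese (r : R) : R := Num.sqrt (1 + r ^+ 2).

Definition partial (i : 'I_n) f : 'rV[R]_n -> R :=
  fun x => 'D_(delta_mx ord0 i) f x.

Fixpoint Ck (k : nat) f : Prop :=
  continuous f /\
  if k is k'.+1 then
    (forall i x, derivable f x (delta_mx ord0 i)) /\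
    forall i, Ck k' (partial i f)
  else True.

Definition smooth f : Prop := forall k, Ck k f.

Definition closed_support f : set 'rV[R]_n := closure [set x | f x != 0].

Definition test_function psi : Prop := smooth psi /\ compact (closed_support psi).

Definition grad_norm f x : R := Num.sqrt (\sum_i partial i f x ^+ 2).

Definition hess_norm f x : R :=
  Num.sqrt (\sum_i \sum_j partial i (partial j f) x ^+ 2).

End calculus.

Section geometry.
Context {R : realType} {n : nat}.
Implicit Types (g : 'rV[R]_n -> 'M[R]_n) (K : R -> R) (f : 'rV[R]_n -> R).

Definition quad (A : 'M[R]_n) (xi : 'rV[R]_n) : R :=
  (xi *m A *m xi^T) ord0 ord0.

Definition riemannian_metric g : Prop :=
  [/\ forall j k, smooth (fun x => g x j k),
      forall x, (g x)^T = g x &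
      forall x xi, xi != 0 -> 0 < quad (g x) xi].

Definition radial_int K (r : R) : R :=
  \int[lebesgue_measure]_(s in `[0, r]) K s.

(* The matrix of dr (x) dr: dr = x_j dx^j / |x|. At x = 0 it is 0. *)
Definition dr2 (x : 'rV[R]_n) : 'M[R]_n :=
  \matrix_(j, k) (x ord0 j / enorm x * (x ord0 k / enorm x)).

(* K^2 dr^2 + r^2 domega^2 in Cartesian coordinates, using
   |dx|^2 = dr^2 + r^2 domega^2. At the origin this is the identity, which is
   also the only value that can make g_1 continuous there (forcing K 0 = 1). *)
Definition radial_metric K (x : 'rV[R]_n) : 'M[R]_n :=
  K (enorm x) ^+ 2 *: dr2 x + (1%:M - dr2 x).

Record asymptotically_euclidean g K : Prop := AsymptoticallyEuclidean {
  ae_metric : riemannian_metric g ;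
  ae_K_continuous : {within `[0, +oo[, continuous K} ;
  ae_K_C2 : forall r : R, 0 < r ->
    [/\ derivable K r 1, derivable (derive1 K) r 1 &
        {for r, continuous (derive1n 2 K)}] ;
  ae_K_decay : exists2 rho, 0 < rho &
    exists C, forall (m : nat) (r : R), (m <= 2)%N -> 0 < r ->
      `|derive1n m (fun s => K s - 1) r| <= C * japanese r `^ (- m%:R - rho) ;
  ae_g2_C2 : forall j k, Ck 2 (fun x => (g x - radial_metric K x) j k) ;
  ae_g2_decay : exists2 beta, 0 < beta &
    exists C, forall j k x,
      let g2 := fun y => (g y - radial_metric K y) j k in
      grad_norm g2 x + `|g2 x| <= C * expR (- (beta * radial_int K (enorm x))) ;
  ae_g2_hess : exists C, forall j k x,
      hess_norm (fun y => (g y - radial_metric K y) j k) x <= C ;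
  ae_elliptic : exists delta0, [/\ 0 < delta0, delta0 < 1,
      forall x xi, delta0 * enorm xi ^+ 2 <= quad (invmx (g x)) xi /\
                   quad (invmx (g x)) xi <= delta0^-1 * enorm xi ^+ 2 &
      forall r, 0 <= r -> delta0 < K r /\ K r < delta0^-1] }.

Definition vol_density g (x : 'rV[R]_n) : R := Num.sqrt (\det (g x)).

Definition vol_int g f : R :=
  \int[lebesgue_rV n]_x (f x * vol_density g x).

Definition laplace_beltrami g f : 'rV[R]_n -> R := fun x =>
  (vol_density g x)^-1 *
  \sum_j partial j (fun y =>
    vol_density g y * \sum_k invmx (g y) j k * partial k f y) x.

Definition growing_eigenfunction g K (c0 lambda : R) (phi : 'rV[R]_n -> R) :
    Prop :=
  [/\ smooth phi,
      forall x, laplace_beltrami g phi x = lambda ^+ 2 * phi x &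
      forall x, c0 < phi x /\
        phi x < c0^-1 * japanese (lambda * enorm x) `^ (- ((n%:R - 1) / 2))
                * expR (lambda * radial_int K (enorm x))].

End geometry.

Section weak_solutions.
Context {R : realType} {n : nat}.
Implicit Types (g : 'rV[R]_n -> 'M[R]_n) (K : R -> R) (T : \bar R)
  (f psi : 'rV[R]_n -> R) (u v w : R -> 'rV[R]_n -> R).

Definition time_interval T : set R := [set t | 0 <= t /\ (t%:E < T)%E].

(* h' is the derivative of h on A, one-sided at the end points lying in A. *)
Definition derivative_within (A : set R) (h h' : R -> R) : Prop :=
  forall t, A t ->
    ((h s - h t) / (s - t)) @[s --> within (A `\ t) (nbhs t)] --> h' t.

(* Action on psi of the distribution f dv_g. As laplace_beltrami is symmetric
   for dv_g, the distribution Delta_g f acts by pairing f (Delta_g psi). *)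
Definition pairing g f psi : R := vol_int g (fun x => f x * psi x).

Definition locally_integrable f : Prop :=
  measurable_fun [set: 'rV[R]_n] f /\
  forall A : set 'rV[R]_n, compact A ->
    (lebesgue_rV n).-integrable A (EFin \o f).

(* w is in C^2([0,T); D') and solves, in D',
   w_tt - a^2 Delta_g w = F, w(0) = w0, w_t(0) = w1. *)
Definition wave_cauchy g (a : R) (F : R -> 'rV[R]_n -> R)
    (w0 w1 : 'rV[R]_n -> R) T w : Prop :=
  forall psi, test_function psi ->
  exists w' w'' : R -> R,
    [/\ [/\ derivative_within (time_interval T) (fun t => pairing g (w t) psi) w',
            derivative_within (time_interval T) w' w'' &
            {within time_interval T, continuous w''}],
        pairing g (w 0) psi = pairing g w0 psi,
        w' 0 = pairing g w1 psi &
        forall t, 0 < t -> (t%:E < T)%E ->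
          w'' t - a ^+ 2 * pairing g (w t) (laplace_beltrami g psi)
          = pairing g (F t) psi].

(* The support, in [0,T) x R^n, of a time-dependent function given up to null
   sets at each time; it agrees with the support as a distribution. *)
Definition ess_support T w : set (R * 'rV[R]_n) :=
  [set z | time_interval T z.1 /\
    ~ exists2 A : set (R * 'rV[R]_n), nbhs z A &
        forall s, time_interval T s ->
          {ae lebesgue_rV n, forall y, A (s, y) -> w s y = 0}].

Definition forward_domain K (a R1 : R) : set (R * 'rV[R]_n) :=
  [set z | radial_int K (enorm z.2) <= a * z.1 + R1].

(* The nonlinear terms make sense only for functions, so u(t) and v(t) are
   functions; |u|^q and |v|^p locally integrable with p, q > 1 makes
   u(t), v(t) locally integrable. *)
Record weak_solution g K (p q c R1 eps : R) (u0 u1 v0 v1 : 'rV[R]_n -> R)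
    T u v : Prop := WeakSolution {
  ws_T_gt0 : (0 < T)%E ;
  ws_measurable : forall t, time_interval T t ->
    measurable_fun [set: 'rV[R]_n] (u t) /\
    measurable_fun [set: 'rV[R]_n] (v t) ;
  ws_locally_integrable : forall t, time_interval T t ->
    locally_integrable (fun x => `|u t x| `^ q) /\
    locally_integrable (fun x => `|v t x| `^ p) ;
  ws_continuous : forall psi, test_function psi ->
    {within time_interval T,
       continuous (fun t => pairing g (fun x => `|u t x| `^ q) psi)} /\
    {within time_interval T,
       continuous (fun t => pairing g (fun x => `|v t x| `^ p) psi)} ;
  ws_eq_u : wave_cauchy g c (fun t x => `|v t x| `^ p)
              (fun x => eps * u0 x) (fun x => eps * u1 x) T u ;
  ws_eq_v : wave_cauchy g 1 (fun t x => `|u t x| `^ q)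
              (fun x => eps * v0 x) (fun x => eps * v1 x) T v ;
  ws_supp_u : ess_support T u `<=` forward_domain K c R1 ;
  ws_supp_v : ess_support T v `<=` forward_domain K 1 R1 }.

(* Supremum of the times up to which a solution (u, v) on [0,T) continues,
   for a notion of solution sol. *)
Definition lifespan
    (sol : \bar R -> (R -> 'rV[R]_n -> R) -> (R -> 'rV[R]_n -> R) -> Prop)
    T u v : \bar R :=
  ereal_sup [set T' | (T <= T')%E /\ exists u' v', sol T' u' v' /\
    forall t, time_interval T t -> u' t = u t /\ v' t = v t].

End weak_solutions.

Definition Gamma_SS {R : realType} (p q : R) (n : nat) : R :=
  Num.max ((p + 2 + q^-1) / (p * q - 1)) ((q + 2 + p^-1) / (p * q - 1))
  - (n%:R - 1) / 2.

(* Main.v *)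
Require Import Defs.
From mathcomp Require Import all_boot all_order all_algebra perm.
From mathcomp Require Import all_classical all_reals all_analysis.
From mathcomp Require Import measurable_realfun simple_functions ring lra.

(** The solution is followed through a few averages over space, which satisfy
ordinary differential inequalities that cannot hold for long.

Write Phi(r) for the integral of K over [0, r]. At time t, a solution w of a
wave equation of speed a is supported in the ball {Phi(|x|) <= a t + R1}, so
all test functions may be multiplied by a smooth cutoff that equals 1 on that
ball ([cutoff], [laplace_beltrami_cutoff_mul]). Two test functions are used.

- The constant 1 is killed by the Laplacian: the averages U and V of u and v
  satisfy U'' = integral of |v|^p and V'' = integral of |u|^q.
- The eigenfunction phi: G = integral of w phi satisfies
  G'' >= (a lambda)^2 G, and the assumptions on the data force
  G(t) >= eps G_0 exp(a lambda t) ([wave_energy],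
  [exponential_lower_bound]).

Hoelder's inequality on the ball bounds the integral of |w|^m from below by
either average ([mass_lower_bounds]). For the constant 1 the cost is a power
of the volume, of order (1 + t)^(n (m - 1)). For phi one needs the integral of
phi^m', m' = m / (m - 1), over {Phi <= s}: the ball is cut into layers on which
Phi varies by 1; a layer at height y has volume O((1 + y)^(n - 1)), and the
growth of phi makes the outermost layer dominate, which yields
(1 + s)^((n - 1) (1 - m' / 2)) exp(m' lambda s) ([weighted_sublevel_bound]).
The exponentials cancel against the growth of G, and altogether
([averaged_system])

  U'' >= k eps^p (1 + t)^((n - 1) (1 - p / 2)),
  U'' >= k (1 + t)^(- n (p - 1)) |V|^p,
  V'' >= k (1 + t)^(- n (q - 1)) |U|^q,

together with the same inequalities after exchanging (U, p) and (V, q).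

On a window [T0, 2 T0] the weights are powers of T0 up to constants. The first
inequality makes U of size eps^p T0^(2 + (n - 1) (1 - p / 2)), whereas the two
others force blow-up inside the window as soon as U exceeds a constant times
T0^(n - (2 p + 2) / (p q - 1)) ([coupled_blowup]). The quotient of the two sizes
is (eps T0^Gamma)^p with Gamma = (q + 2 + 1/p) / (p q - 1) - (n - 1) / 2, so no
solution can reach 2 T0 for T0 = C eps^(-1/Gamma) ([system_lifespan]).
Exchanging the roles of U and V gives the other term of the maximum in
[Gamma_SS]. *)

Set Implicit Arguments.
Unset Strict Implicit.
Unset Printing Implicit Defensive.

Import Order.TTheory GRing.Theory Num.Theory.
Import numFieldNormedType.Exports.

Local Open Scope classical_set_scope.
Local Open Scope ring_scope.

(** * Blow-up for a coupled system of differential inequalities *)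

Section second_order.
Context {R : realType}.

(** Continuity up to the end points and a derivative in the interior: what the
mean value theorem uses, and what a one-sided derivative at time 0 provides. *)
Definition differentiable_on (a b : R) (f f1 : R -> R) :=
  {within `[a, b], continuous f} /\
  forall x, x \in `]a, b[ -> is_derive x 1 f (f1 x).

Lemma differentiable_onS a b a' b' (f f1 : R -> R) : a <= a' -> b' <= b ->
  differentiable_on a b f f1 -> differentiable_on a' b' f f1.
Proof.
move=> aa' bb' [cf df]; split.
  apply: continuous_subspaceW cf => x /=; rewrite !in_itv/= => /andP[h1 h2].
  by rewrite (le_trans aa' h1) (le_trans h2 bb').
move=> x; rewrite in_itv/= => /andP[h1 h2]; apply: df.
by rewrite in_itv/= (le_lt_trans aa' h1) (lt_le_trans h2 bb').
Qed.

Lemma differentiable_on_ge (a b : R) (f f1 : R -> R) m : a <= b ->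
  differentiable_on a b f f1 -> (forall x, x \in `]a, b[ -> m <= f1 x) ->
  f a + m * (b - a) <= f b.
Proof.
rewrite le_eqVlt => /predU1P[-> _ _|ab [cf df] fm]; first by rewrite subrr mulr0 addr0.
have [c cab e] := MVT ab df cf.
have : m * (b - a) <= f1 c * (b - a) by rewrite ler_pM2r ?subr_gt0//; exact: fm.
by rewrite -e; lra.
Qed.

(** The slope reaches m (b - a) / 2 at the midpoint, and the second half of the
interval contributes this slope times (b - a) / 2. *)
Lemma convex_growth (a b : R) (f f1 f2 : R -> R) m : a <= b -> 0 <= m -> 0 <= f1 a ->
  differentiable_on a b f f1 -> differentiable_on a b f1 f2 ->
  (forall x, x \in `]a, b[ -> m <= f2 x) ->
  f a + m * ((b - a) ^+ 2 / 4) <= f b.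
Proof.
move=> ab m0 f1a df df1 f2m; pose c := (a + b) / 2.
have ac : a <= c by rewrite /c; lra.
have cb : c <= b by rewrite /c; lra.
have f1x x : a <= x -> x <= b -> m * (x - a) <= f1 x.
  move=> ax xb.
  suff : f1 a + m * (x - a) <= f1 x by apply: le_trans; rewrite lerDr.
  apply: differentiable_on_ge ax (differentiable_onS (lexx a) xb df1) _ => y.
  by rewrite !in_itv/= => /andP[h1 h2]; apply: f2m; rewrite in_itv/= h1 (lt_le_trans h2).
have h1 : f a + 0 * (c - a) <= f c.
  apply: differentiable_on_ge ac (differentiable_onS (lexx a) cb df) _ => y.
  rewrite in_itv/= => /andP[h1 h2]; apply: le_trans (f1x y (ltW h1) (le_trans (ltW h2) cb)).
  by rewrite mulr_ge0// subr_ge0 ltW.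
have h2 : f c + (m * (c - a)) * (b - c) <= f b.
  apply: differentiable_on_ge cb (differentiable_onS ac (lexx b) df) _ => y.
  rewrite in_itv/= => /andP[h2 h3]; apply: le_trans (f1x y (le_trans ac (ltW h2)) (ltW h3)).
  by rewrite ler_wpM2l// lerD2r ltW.
have -> : m * ((b - a) ^+ 2 / 4) = (m * (c - a)) * (b - c) by rewrite /c; field.
lra.
Qed.

Lemma powR_expR (x a : R) : expR x `^ a = expR (a * x).
Proof. by rewrite /powR gt_eqF ?expR_gt0// expRK. Qed.

Lemma expn_expR (x : R) k : 0 < x -> x ^+ k = expR (k%:R * ln x).
Proof. by move=> x0; rewrite -[in LHS](lnK x0) -expRM_natl. Qed.

Lemma exists_expR (x : R) : 0 < x -> exists y, x = expR y.
Proof. by move=> x0; exists (ln x); rewrite lnK. Qed.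


(** Half a step of the blow-up iteration: a lower bound on one unknown drives the
other one. *)
Lemma power_growth (f f1 f2 g : R -> R) (a b k r M : R) : a <= b ->
  differentiable_on a b f f1 -> differentiable_on a b f1 f2 ->
  0 <= f a -> 0 <= f1 a -> 0 <= k -> 0 <= r -> 0 <= M ->
  (forall t, t \in `]a, b[ -> M <= g t) ->
  (forall t, t \in `]a, b[ -> k * `|g t| `^ r <= f2 t) ->
  k * M `^ r * ((b - a) ^+ 2 / 4) <= f b.
Proof.
move=> ab df df1 fa f1a k0 r0 M0 Mg H.
have := convex_growth (m := k * M `^ r) ab _ f1a df df1 => H1.
apply: le_trans (H1 _ _); first by rewrite lerDr.
  by rewrite mulr_ge0 ?powR_ge0.
move=> t tab; apply: le_trans (H t tab).
rewrite ler_wpM2l// ge0_ler_powR ?nnegrE//.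
by apply: le_trans (ler_norm _); exact: Mg.
Qed.

Lemma ge0_increasing (f f1 : R -> R) (a b : R) :
  differentiable_on a b f f1 -> (forall t, t \in `]a, b[ -> 0 <= f1 t) ->
  forall s t, a <= s -> s <= t -> t <= b -> f s <= f t.
Proof.
move=> d f1p s t as_ st tb.
have := differentiable_on_ge (m := 0) st (differentiable_onS as_ tb d).
rewrite mul0r addr0; apply=> x; rewrite in_itv/= => /andP[sx xt].
by apply: f1p; rewrite in_itv/= (le_lt_trans as_ sx) (lt_le_trans xt tb).
Qed.

(** One step of the blow-up iteration, of length 2 h = T0 / 2^(j + 2): in its first
half the bound M0 L^j on U drives V through |U|^q, in its second half V drives U
through |V|^p. Both halves lose a factor h^2 / 4, in total 4^(-(1 + p)) more at
each step; since L^(p q - 1) = 4^(1 + p), the superlinear power p q makes up for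
this loss, and there remains one factor L. *)
Lemma iteration_gain (p q A B T0 M0 : R) (j : nat) (L := 4 `^ ((1 + p) / (p * q - 1)))
    (h := T0 * 2^-1 ^+ j / 8) :
  0 < p * q - 1 -> 0 < A -> 0 < B -> 0 < T0 -> 0 < M0 ->
  L <= A * B `^ p * T0 `^ (2 + 2 * p) * 4 `^ (- (4 * (1 + p))) * M0 `^ (p * q - 1) ->
  M0 * L ^+ j.+1 <=
    A * (B * (M0 * L ^+ j) `^ q * (h ^+ 2 / 4)) `^ p * (h ^+ 2 / 4).
Proof.
move=> pq A_0 B_0 T_0 M_0 Hbig.
have L0 : 0 < L by rewrite /L powR_gt0.
set M := M0 * L ^+ j.
have M0' : 0 < M by rewrite mulr_gt0// exprn_gt0.
have {}Hbig := ler_wpM2r (ltW M0') Hbig.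
have -> : M0 * L ^+ j.+1 = L * M by rewrite /M exprS mulrCA.
apply: le_trans Hbig _.
rewrite le_eqVlt; apply/orP; left; apply/eqP.
have e4 (x : R) : 4 `^ x = expR (x * ln 4) by rewrite /powR gt_eqF.
have eh2 : h ^+ 2 / 4 = expR (2 * ln T0 - (4 + j%:R) * ln 4).
  have -> : h ^+ 2 / 4 = T0 ^+ 2 * (4 ^+ j)^-1 * (4 ^+ 4)^-1.
    rewrite /h (_ : (4 ^+ j)^-1 = (2^-1 ^+ j) ^+ 2 :> R); first by field.
    by rewrite -exprVn -exprM mulnC exprM; congr (_ ^+ _); field.
  by rewrite !expn_expR// -!expRN -!expRD; congr expR; ring.
have eL : L = expR ((1 + p) / (p * q - 1) * ln 4) by rewrite /L e4.
rewrite eh2 /M expn_expR// eL expRK !e4.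
have [a ea] := exists_expR A_0; have [b eb] := exists_expR B_0.
have [m em] := exists_expR M_0; have [t et] := exists_expR T_0.
rewrite ea eb em et !expRK !(powR_expR, =^~expRD); congr expR.
by field; rewrite gt_eqF.
Qed.

Lemma exists_geometric_gt (M L x : R) : 0 < M -> 1 < L ->
  exists k : nat, x < M * L ^+ k.
Proof.
move=> M0 L1.
have ML : 0 < M * (L - 1) by rewrite mulr_gt0// subr_gt0.
have := archi_boundP (normr_ge0 (x / (M * (L - 1)))).
set k := Num.bound _ => hk; exists k.
move/(le_lt_trans (ler_norm _)) : hk; rewrite ltr_pdivrMr// => /lt_le_trans; apply.
rewrite mulrCA ler_pM2l//.
suff : 1 + k%:R * (L - 1) <= L ^+ k by apply: le_trans; rewrite lerDr.
elim: k => [|i IHi]; first by rewrite mul0r addr0.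
rewrite exprS; apply: le_trans (_ : L * (1 + i%:R * (L - 1)) <= _); last first.
  by rewrite ler_pM2l// (lt_trans ltr01).
have i0 : 0 <= i%:R * (L - 1) ^+ 2 by rewrite mulr_ge0// sqr_ge0.
rewrite -natr1 -subr_ge0 (_ : _ - _ = i%:R * (L - 1) ^+ 2)//; ring.
Qed.

(** Convexity gives U >= M0 = A0 T0^2 / 16 at time 3 T0 / 2. From there on the
iteration runs along the times t_j = 2 T0 - T0 / 2^(j + 1): it gives
U(t_j) >= M0 L^j with L > 1. As these times stay below 2 T0 and U is
nondecreasing, U(2 T0) would be infinite. *)
Lemma coupled_blowup (p q A0 A B T0 : R) (U U1 U2 V V1 V2 : R -> R) :
  1 < p -> 1 < q -> 0 < A0 -> 0 < A -> 0 < B -> 0 < T0 ->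
  differentiable_on T0 (2 * T0) U U1 -> differentiable_on T0 (2 * T0) U1 U2 ->
  differentiable_on T0 (2 * T0) V V1 -> differentiable_on T0 (2 * T0) V1 V2 ->
  0 <= U T0 -> 0 <= U1 T0 -> 0 <= V T0 -> 0 <= V1 T0 ->
  (forall t, t \in `]T0, 2 * T0[ -> A0 <= U2 t) ->
  (forall t, t \in `]T0, 2 * T0[ -> A * `|V t| `^ p <= U2 t) ->
  (forall t, t \in `]T0, 2 * T0[ -> B * `|U t| `^ q <= V2 t) ->
  4 `^ ((1 + p) / (p * q - 1)) <=
    A * B `^ p * T0 `^ (2 + 2 * p) * 4 `^ (- (4 * (1 + p))) *
    (A0 * T0 ^+ 2 / 16) `^ (p * q - 1) -> False.
Proof.
move=> p1 q1 A00 A_0 B_0 T_0 dU dU1 dV dV1 U0 U10 V0 V10 HA0 HA HB Hbig.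
have pq1 : 0 < p * q - 1 by rewrite subr_gt0 -[X in X < _]mulr1 ltr_pM.
have p0 : 0 <= p by rewrite ltW// (lt_trans ltr01).
have q0 : 0 <= q by rewrite ltW// (lt_trans ltr01).
have HU2 t : t \in `]T0, 2 * T0[ -> 0 <= U2 t.
  by move=> tI; apply: le_trans (HA0 t tI); exact: ltW.
have HV2 t : t \in `]T0, 2 * T0[ -> 0 <= V2 t.
  by move=> tI; apply: le_trans (HB t tI); rewrite mulr_ge0 ?powR_ge0// ltW.
have U1p t : T0 <= t -> t <= 2 * T0 -> 0 <= U1 t.
  by move=> *; apply: le_trans U10 _; exact: (ge0_increasing dU1 HU2).
have V1p t : T0 <= t -> t <= 2 * T0 -> 0 <= V1 t.
  by move=> *; apply: le_trans V10 _; exact: (ge0_increasing dV1 HV2).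
have monoU : forall s t, T0 <= s -> s <= t -> t <= 2 * T0 -> U s <= U t.
  apply: ge0_increasing dU _ => t; rewrite in_itv/= => /andP[? ?].
  by apply: U1p; exact: ltW.
have monoV : forall s t, T0 <= s -> s <= t -> t <= 2 * T0 -> V s <= V t.
  apply: ge0_increasing dV _ => t; rewrite in_itv/= => /andP[? ?].
  by apply: V1p; exact: ltW.
have II a b x : T0 <= a -> b <= 2 * T0 -> x \in `]a, b[ -> x \in `]T0, 2 * T0[.
  rewrite !in_itv/= => h1 h2 /andP[h3 h4].
  by rewrite (le_lt_trans h1 h3) (lt_le_trans h4 h2).
pose M0 := A0 * T0 ^+ 2 / 16.
have M00 : 0 < M0 by rewrite /M0 divr_gt0// mulr_gt0// exprn_gt0.
have base : M0 <= U (2 * T0 - T0 * 2^-1).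
  have a1 : T0 <= 2 * T0 - T0 * 2^-1 by clear -T_0; lra.
  have a2 : 2 * T0 - T0 * 2^-1 <= 2 * T0 by clear -T_0; lra.
  have := convex_growth (m := A0) a1 (ltW A00) U10
    (differentiable_onS (lexx _) a2 dU) (differentiable_onS (lexx _) a2 dU1).
  move=> H; apply: le_trans (H _); last by move=> x /(II _ _ _ (lexx _) a2); exact: HA0.
  have -> : A0 * ((2 * T0 - T0 / 2 - T0) ^+ 2 / 4) = M0 by rewrite /M0; field.
  by rewrite lerDr.
pose L := 4 `^ ((1 + p) / (p * q - 1)).
rewrite -/M0 in Hbig.
have L1 : 1 < L.
  rewrite /L /powR gt_eqF // expR_gt1 mulr_gt0 ?ln_gt0 ?ltr1n// divr_gt0//.
  by rewrite addr_gt0// (lt_trans ltr01).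
have L0 : 0 < L by rewrite (lt_trans ltr01).
have time (j : nat) (d := 2^-1 ^+ j : R) (h := T0 * d / 8) (s := 2 * T0 - T0 * 2^-1 ^+ j.+1) :
  [/\ T0 <= s, 0 <= h, s + h + h <= 2 * T0 & 2 * T0 - T0 * 2^-1 ^+ j.+2 = s + h + h].
  have d0 : 0 < d by rewrite exprn_gt0// invr_gt0.
  have d1 : d <= 1 by rewrite exprn_ile1// ?invr_ge0// invf_le1// ler1n.
  have T0d : T0 * d <= T0 by rewrite ler_piMr// ltW.
  have T0d0 : 0 < T0 * d by rewrite mulr_gt0.
  rewrite /h /s !exprS -/d; clear -T0d T0d0.
  split; by [lra|field].
have step (j : nat) : M0 * L ^+ j <= U (2 * T0 - T0 * 2^-1 ^+ j.+1).
  elim: j => [|j IH]; first by rewrite expr0 mulr1 expr1.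
  have [] := time j.
  set s := 2 * T0 - _ in IH *; set h := T0 * _ / 8 => Ts h0 shT ->.
  have ssh : s <= s + h by rewrite lerDl.
  have shsh : s + h <= s + h + h by rewrite lerDl.
  have Tsh := le_trans Ts ssh.
  have shT' := le_trans shsh shT.
  have sT := le_trans ssh shT'.
  have M_0 : 0 <= M0 * L ^+ j by rewrite mulr_ge0// ?exprn_ge0 ?(ltW L0)// ltW.
  apply: le_trans (iteration_gain j pq1 A_0 B_0 T_0 M00 Hbig) _.
  rewrite -/L -/h; set M := M0 * L ^+ j in IH M_0 *.
  have VN : B * M `^ q * (h ^+ 2 / 4) <= V (s + h).
    rewrite -[h in h ^+ 2](addrK s) [h + s]addrC.
    apply: (@power_growth V V1 V2 U) => //.
    - exact: differentiable_onS dV.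
    - exact: differentiable_onS dV1.
    - by apply: (le_trans V0); apply: monoV.
    - exact: V1p.
    - exact: ltW.
    - move=> t; rewrite in_itv/= => /andP[st tsh]; apply: le_trans IH _.
      by apply: monoU => //; [exact: ltW|exact: le_trans (ltW tsh) shT'].
    - by move=> t /(II _ _ _ Ts shT'); exact: HB.
  set N := B * M `^ q * (h ^+ 2 / 4) in VN *.
  have N_0 : 0 <= N by rewrite !mulr_ge0// ?powR_ge0// ?exprn_ge0// ltW.
  rewrite -[h in h ^+ 2](addrK (s + h)) [h + (s + h)]addrC.
  apply: (@power_growth U U1 U2 V) => //.
  - exact: differentiable_onS dU.
  - exact: differentiable_onS dU1.
  - by apply: (le_trans U0); apply: monoU.
  - exact: U1p.
  - exact: ltW.
  - move=> t; rewrite in_itv/= => /andP[st tsh]; apply: le_trans VN _.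
    by apply: monoV => //; [exact: ltW|exact: le_trans (ltW tsh) shT].
  - by move=> t /(II _ _ _ Tsh shT); exact: HA.
have [k Hk] := exists_geometric_gt (U (2 * T0)) M00 L1.
have [Ts h0 shT e] := time k.
have sT : 2 * T0 - T0 * 2^-1 ^+ k.+1 <= 2 * T0.
  by apply: le_trans shT; rewrite -addrA lerDl addr_ge0.
by have := le_trans (step k) (monoU _ _ Ts sT (lexx _)); rewrite leNgt Hk.
Qed.

(** On a dyadic window 1 + t is T up to a factor between 1 and 3, so that its powers
of either sign are those of T. *)
Lemma powR_window (T t e : R) : 1 <= T -> T <= t -> t <= 2 * T ->
  3 `^ (- `|e|) * T `^ e <= (1 + t) `^ e.
Proof.
move=> T1 Tt tT.
have T0 : 0 < T by rewrite (lt_le_trans ltr01).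
have [y y1 [y3 ->]] : exists2 y, 1 <= y & y <= 3 /\ 1 + t = y * T.
  exists ((1 + t) / T); last split.
  - by rewrite ler_pdivlMr// mul1r; lra.
  - by rewrite ler_pdivrMr//; lra.
  - by rewrite divfK// gt_eqF.
have y0 : 0 < y by rewrite (lt_le_trans ltr01).
rewrite (powRM _ (ltW y0) (ltW T0)) ler_pM2r ?powR_gt0//.
rewrite /powR !gt_eqF// ler_expR mulNr lerNl.
apply: le_trans (ler_norm _) _; rewrite normrN normrM ler_wpM2l//.
by rewrite ger0_norm ?ln_ge0// ler_ln ?posrE.
Qed.

(** On the window [T0, 2 T0] with T0 = C eps^(-1/Gam), the quantity that
[coupled_blowup] requires to be large is a constant times
(eps T0^Gam)^(p (p q - 1)): all powers of T0 combine into this one. It is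
therefore a constant times C^(Gam p (p q - 1)), and C is chosen large. *)
Lemma system_lifespan (p q k N : R)
    (Gam := (q + 2 + p^-1) / (p * q - 1) - (N - 1) / 2) :
  1 < p -> 1 < q -> 0 < k -> 0 < Gam ->
  exists2 C, 0 < C & forall eps, 0 < eps -> eps < 1 ->
  forall (T0 := C * eps `^ (- Gam^-1)) (U U1 U2 V V1 V2 : R -> R),
  differentiable_on 0 (2 * T0) U U1 -> differentiable_on 0 (2 * T0) U1 U2 ->
  differentiable_on 0 (2 * T0) V V1 -> differentiable_on 0 (2 * T0) V1 V2 ->
  0 <= U 0 -> 0 <= U1 0 -> 0 <= V 0 -> 0 <= V1 0 ->
  (forall t, t \in `]0, 2 * T0[ ->
    k * eps `^ p * (1 + t) `^ ((N - 1) * (1 - p / 2)) <= U2 t) ->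
  (forall t, t \in `]0, 2 * T0[ ->
    k * (1 + t) `^ (- (N * (p - 1))) * `|V t| `^ p <= U2 t) ->
  (forall t, t \in `]0, 2 * T0[ ->
    k * (1 + t) `^ (- (N * (q - 1))) * `|U t| `^ q <= V2 t) -> False.
Proof.
move=> p1 q1 k0 G0.
have p0 : 0 < p by rewrite (lt_trans ltr01).
have pq1 : 0 < p * q - 1 by rewrite subr_gt0 -[X in X < _]mulr1 ltr_pM.
pose ea := (N - 1) * (1 - p / 2); pose eA := - (N * (p - 1)); pose eB := - (N * (q - 1)).
have [l4 e4] := exists_expR (ltr0n R 4).
have [l3 e3] := exists_expR (ltr0n R 3).
have [lk ek] := exists_expR k0.
(* The logarithm of the right-hand side of the blow-up condition is const + D c,
where c = ln C. *)
pose const := (lk - `|eA| * l3) + p * (lk - `|eB| * l3) - 4 * (1 + p) * l4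
  + (p * q - 1) * (lk - `|ea| * l3 - 2 * l4).
pose D := (p * q - 1) * p * Gam.
have D0 : 0 < D by rewrite /D !mulr_gt0.
pose c := Num.max 0 (((1 + p) / (p * q - 1) * l4 - const) / D).
exists (expR c); first exact: expR_gt0.
move=> eps eps0 eps1 T0 U U1 U2 V V1 V2 dU dU1 dV dV1 U0 U10 V0 V10 H0 HA HB.
have [s es] := exists_expR eps0.
have s0 : s <= 0 by move: eps1; rewrite es expR_lt1 => /ltW.
have [t et tE] : exists2 t, T0 = expR t & t = c - s / Gam.
  by eexists; last reflexivity; rewrite /T0 es powR_expR -expRD mulNr mulrC.
have t0 : 0 <= t.
  rewrite tE; apply: addr_ge0; first by rewrite le_max lexx.
  by rewrite -mulNr divr_ge0 ?oppr_ge0// ltW.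
have T1 : 1 <= T0 by rewrite et -expR0 ler_expR.
have T_0 : 0 < T0 by rewrite (lt_le_trans ltr01).
have II x : x \in `]T0, 2 * T0[ -> [/\ x \in `]0, 2 * T0[, T0 <= x & x <= 2 * T0].
  rewrite !in_itv/= => /andP[h1 h2]; rewrite h2 (lt_trans T_0 h1)/=.
  by split => //; exact: ltW.
have TT : T0 <= 2 * T0 by rewrite ler_peMl ?ler1n// ltW.
have HU2 x : x \in `]0, 2 * T0[ -> 0 <= U2 x.
  by move=> /H0; apply: le_trans; rewrite mulr_ge0 ?powR_ge0// mulr_ge0 ?powR_ge0// ltW.
have HV2 x : x \in `]0, 2 * T0[ -> 0 <= V2 x.
  by move=> /HB; apply: le_trans; rewrite mulr_ge0 ?powR_ge0// mulr_ge0 ?powR_ge0// ltW.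
have U1p x : 0 <= x -> x <= 2 * T0 -> 0 <= U1 x.
  by move=> *; apply: le_trans U10 _; exact: (ge0_increasing dU1 HU2).
have V1p x : 0 <= x -> x <= 2 * T0 -> 0 <= V1 x.
  by move=> *; apply: le_trans V10 _; exact: (ge0_increasing dV1 HV2).
have UT : 0 <= U T0.
  apply: le_trans U0 _; apply: (ge0_increasing dU) => //; last exact: ltW.
  by move=> x; rewrite in_itv/= => /andP[h1 h2]; apply: U1p; exact: ltW.
have VT : 0 <= V T0.
  apply: le_trans V0 _; apply: (ge0_increasing dV) => //; last exact: ltW.
  by move=> x; rewrite in_itv/= => /andP[h1 h2]; apply: V1p; exact: ltW.
have restr f f1 : differentiable_on 0 (2 * T0) f f1 ->
    differentiable_on T0 (2 * T0) f f1.
  by apply: differentiable_onS => //; exact: ltW.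
apply: (@coupled_blowup p q (k * (3 `^ (- `|ea|) * T0 `^ ea) * eps `^ p)
  (k * (3 `^ (- `|eA|) * T0 `^ eA)) (k * (3 `^ (- `|eB|) * T0 `^ eB)) T0 U U1 U2 V V1 V2) => //.
- by rewrite !mulr_gt0// powR_gt0.
- by rewrite !mulr_gt0// powR_gt0.
- by rewrite !mulr_gt0// powR_gt0.
- exact: restr.
- exact: restr.
- exact: restr.
- exact: restr.
- by apply: U1p => //; exact: ltW.
- by apply: V1p => //; exact: ltW.
- move=> x /II[h1 h2 h3]; apply: le_trans (H0 x h1).
  rewrite mulrAC ler_wpM2l ?mulr_ge0 ?powR_ge0 ?(ltW k0)//.
  exact: powR_window.
- move=> x /II[h1 h2 h3]; apply: le_trans (HA x h1).
  rewrite ler_wpM2r ?powR_ge0// ler_wpM2l ?(ltW k0)//.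
  exact: powR_window.
- move=> x /II[h1 h2 h3]; apply: le_trans (HB x h1).
  rewrite ler_wpM2r ?powR_ge0// ler_wpM2l ?(ltW k0)//.
  exact: powR_window.
rewrite (_ : 16 = 4 ^+ 2); last by rewrite expr2; ring.
rewrite !expn_expR// et es ek e3 e4 !expRK -expRN !(powR_expR, =^~expRD) ler_expR.
have : (1 + p) / (p * q - 1) * l4 <= const + D * c.
  by rewrite -lerBlDl [D * c]mulrC -ler_pdivrMr// /c le_max lexx orbT.
congr (_ <= _).
have Dt : D * c = D * t + (p * q - 1) * p * s.
  rewrite tE mulrBr /D; field; by rewrite gt_eqF.
rewrite -e4 Dt /D /const /Gam /ea /eA /eB; field.
by rewrite !gt_eqF.
Qed.
End second_order.

(** * Borel sets and null sets of R^n *)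

Section borel.
Context {R : realType} {n : nat}.

Definition rational_box (z : 'rV[rat]_n * nat) : set 'rV[R]_n :=
  [set y | forall i, `|y ord0 i - ratr (z.1 ord0 i)| < z.2.+1%:R^-1].

Lemma measurable_rational_box z : measurable (rational_box z).
Proof.
rewrite (_ : rational_box z = \bigcap_i
    (@rV_coord R n i @^-1` (ball (ratr (z.1 ord0 i) : R) z.2.+1%:R^-1))).
  apply: fin_bigcap_measurable => // i _.
  rewrite -[X in measurable X]setTI; apply: measurable_rV_coord => //.
  by rewrite ball_itv; exact: measurable_itv.
apply/seteqP; split => y /= H i; last by rewrite distrC; exact: H.
by move=> _; rewrite /rV_coord /ball /= distrC; exact: H.
Qed.

Lemma rational_box_basis (x : 'rV[R]_n) (U : set 'rV[R]_n) : nbhs x U ->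
  exists2 z, rational_box z x & rational_box z `<=` U.
Proof.
move=> /nbhs_ballP[e /= e0 xU].
have [k ke] : exists k : nat, (k.+1%:R^-1 : R) < e / 2.
  exists (Num.bound (e / 2)^-1); rewrite invf_plt ?posrE ?divr_gt0 ?ltr0Sn//.
  apply: lt_trans (archi_boundP _) _; first by rewrite invr_ge0 divr_ge0// ltW.
  by rewrite ltr_nat.
have k0 : 0 < (k.+1%:R^-1 : R) by rewrite invr_gt0 ltr0Sn.
have : forall i, exists q : rat, `|x ord0 i - ratr q| < k.+1%:R^-1.
  move=> i; have : x ord0 i - k.+1%:R^-1 < x ord0 i + k.+1%:R^-1.
    by rewrite ltrD2l; apply: lt_trans k0; rewrite oppr_lt0.
  move=> /rat_in_itvoo[q]; rewrite in_itv/= => /andP[h1 h2]; exists q.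
  by rewrite distrC ltr_distl h1 h2.
move=> /choice[f fP].
exists (\row_i f i, k) => [i/=|y yB]; first by rewrite mxE.
apply: xU; split => // i j; rewrite (ord1 i) /ball /=.
have := yB j; have := fP j; rewrite /= mxE => h1 h2.
rewrite -(subrK (ratr (f j)) (x ord0 j)) -addrA (le_lt_trans (ler_normD _ _))//.
rewrite [e]splitr ltrD ?(lt_trans h1)// distrC.
exact: lt_trans ke.
Qed.

Lemma open_measurable_rV (U : set 'rV[R]_n) : open U -> measurable U.
Proof.
rewrite openE => oU.
have -> : U = \bigcup_(z in [set z | rational_box z `<=` U]) rational_box z.
  apply/seteqP; split => [x /oU /rational_box_basis[z xz zU]|x [z zU]]; first by exists z.
  exact: zU.
rewrite bigcup_mkcond; apply: countable_bigcupT_measurable => // z.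
by case: ifPn => _ //; exact: measurable_rational_box.
Qed.

Lemma continuous_measurable_rV (f : 'rV[R]_n -> R) :
  continuous f -> measurable_fun [set: 'rV[R]_n] f.
Proof.
move=> /continuousP cf; apply: (measurability _ (RGenOpens.measurableE R)).
move=> _ [_ [a [b ->] <-]]; rewrite setTI; apply: open_measurable_rV.
exact/cf/interval_open.
Qed.

(** Lindeloef: a countable base reduces an arbitrary family of neighbourhoods to
countably many, so that the exceptional sets have a null union. *)
Lemma ae_locally (mu : {measure set 'rV[R]_n -> \bar R}) (E : set 'rV[R]_n)
    (P : 'rV[R]_n -> Prop) :
  (forall x, E x -> exists2 U, nbhs x U & {ae mu, forall y, U y -> P y}) ->
  {ae mu, forall y, E y -> P y}.
Proof.
move=> H.
pose good z := {ae mu, forall y, rational_box z y -> P y}.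
have : {ae mu, forall y k, match unpickle k : option ('rV[rat]_n * nat) with
    | Some z => good z -> rational_box z y -> P y | None => True end}.
  apply: ae_foralln => k; case: (unpickle k) => [z|]; last exact/aeW.
  have [gz|ngz] := pselect (good z); last exact/aeW.
  by apply: filterS gz => y ? _.
apply: filterS => y yP Ey; have [U yU UP] := H y Ey.
have [z zy zU] := rational_box_basis yU.
have := yP (pickle z); rewrite pickleK; apply => //.
by apply: filterS UP => w wP /zU.
Qed.

End borel.

Section ae_integral.
Context d (T : measurableType d) (R : realType) (mu : {measure set T -> \bar R}).
Local Open Scope ereal_scope.
Import HBNNSimple.

(** The integral of a nonnegative function is a supremum over the simple functions
below it, and such a function below f can be set to 0 on the exceptional null
set: it is then below g and has the same integral. In this form the statement
applies to products of a solution with the Laplacian of a cutoff function. *)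
Lemma ge0_ae_le_integral_nonmeasurable (f g : T -> \bar R) :
  (forall x, 0 <= f x) -> (forall x, 0 <= g x) ->
  {ae mu, forall x, f x <= g x} -> \int[mu]_x f x <= \int[mu]_x g x.
Proof.
move=> f0 g0 [N [mN N0 fgN]].
rewrite ge0_integralTE// [leRHS]ge0_integralTE//.
apply: ge_ereal_sup => _ [h /= hf <-].
pose h' : {nnsfun T >-> R} := proj_nnsfun h (measurableC mN).
have h'E x : h' x = (h x * \1_(~` N) x)%R by [].
have -> : sintegral mu h = sintegral mu h'.
  rewrite -!integralT_nnsfun; apply: ge0_ae_eq_integral => //.
  - exact/measurable_EFinP.
  - exact/measurable_EFinP.
  - by move=> x _; rewrite lee_fin.
  - by move=> x _; rewrite lee_fin.
  - exists N; split => // x hx; apply: contrapT => Nx; apply: hx => _.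
    by rewrite h'E indicE mem_set// mulr1.
apply: ereal_sup_ubound; exists h' => // x.
rewrite h'E indicE; have [Nx|Nx] := pselect (N x).
  by rewrite memNset ?mulr0//; exact.
rewrite mem_set// mulr1; apply: le_trans (hf x) _.
by apply: contrapT => hx; apply: Nx; apply: fgN.
Qed.

Lemma ae_eq_integral_nonmeasurable (f g : T -> \bar R) :
  {ae mu, forall x, f x = g x} -> \int[mu]_x f x = \int[mu]_x g x.
Proof.
move=> fg; rewrite integralE [RHS]integralE; congr (_ - _); apply/eqP;
  rewrite eq_le; apply/andP; split; apply: ge0_ae_le_integral_nonmeasurable => //;
  by apply: filterS fg => x fgx; rewrite ?funeposE ?funenegE fgx.
Qed.

Lemma ae_eq_Rintegral (f g : T -> R) :
  {ae mu, forall x, f x = g x} -> (\int[mu]_x f x = \int[mu]_x g x)%R.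
Proof.
move=> fg; congr fine; apply: ae_eq_integral_nonmeasurable.
by apply: filterS fg => x ->.
Qed.

End ae_integral.

(** * Volumes of balls and shells *)

Section euclidean_norm.
Context {R : realType} {n : nat}.
Implicit Types x : 'rV[R]_n.

Lemma enorm_ge0 x : 0 <= enorm x. Proof. exact: sqrtr_ge0. Qed.

Lemma coord_le_enorm x i : `|x ord0 i| <= enorm x.
Proof.
rewrite -sqrtr_sqr ler_wsqrtr// (bigD1 i)//= lerDl.
by apply: sumr_ge0 => j _; exact: sqr_ge0.
Qed.

Lemma enormZ (r : R) x : enorm (r *: x) = `|r| * enorm x.
Proof.
rewrite /enorm -sqrtr_sqr -sqrtrM ?sqr_ge0// mulr_sumr; congr Num.sqrt.
by apply: eq_bigr => i _; rewrite mxE exprMn.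
Qed.

Lemma continuous_enorm : continuous (@enorm R n).
Proof.
move=> x; apply: (@continuous_comp _ _ _ _ Num.sqrt); last exact: sqrt_continuous.
move: x; apply: (@continuous_big _ _ +%R 0 xpredT); first exact: add_continuous.
move=> i _ x; apply: (@continuous_comp _ _ _ _ (fun y : R => y ^+ 2)).
  exact: coord_continuous.
exact: exprn_continuous.
Qed.

Lemma measurable_enorm : measurable_fun [set: 'rV[R]_n] (@enorm R n).
Proof. by apply: continuous_measurable_rV; exact: continuous_enorm. Qed.

Lemma measurable_enorm_ball r : measurable [set x : 'rV[R]_n | enorm x <= r].
Proof.
rewrite (_ : [set _ | _] = (@enorm R n) @^-1` `]-oo, r]).
  rewrite -[X in measurable X]setTI.
  by apply: measurable_enorm => //; exact: measurable_itv.
by apply/seteqP; split => x /=; rewrite in_itv.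
Qed.

Lemma enorm_shellE (a b : R) : [set x : 'rV[R]_n | a < enorm x <= b] =
  [set x | enorm x <= b] `\` [set x | enorm x <= a].
Proof.
apply/seteqP; split => x /=.
  by move=> /andP[h1 h2]; split => //; apply/negP; rewrite -ltNge.
by move=> [h1 /negP]; rewrite -ltNge => ->.
Qed.

Lemma measurable_enorm_shell (a b : R) :
  measurable [set x : 'rV[R]_n | a < enorm x <= b].
Proof. by rewrite enorm_shellE; apply: measurableD; exact: measurable_enorm_ball. Qed.

Lemma nbhs_enorm_lt (r : R) x : enorm x < r -> nbhs x [set y : 'rV[R]_n | enorm y < r].
Proof.
move=> xr; apply: open_nbhs_nbhs; split => //.
apply: (@open_comp _ _ (@enorm R n) [set y | y < r]); last exact: open_lt.
by move=> *; exact: continuous_enorm.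
Qed.

End euclidean_norm.

Section scaling.
Context {R : realType}.
Local Open Scope ereal_scope.

Let scaleR (r : R) : measurableTypeR R -> measurableTypeR R := fun x => (r * x)%R.

Let measurable_scaleR r : measurable_fun setT (scaleR r).
Proof. exact: mulrl_measurable. Qed.

Lemma lebesgue_measure_scale (r : R) (A : set (measurableTypeR R)) :
  (0 < r)%R -> measurable A ->
  lebesgue_measure A = r%:E * lebesgue_measure (scaleR r @^-1` A).
Proof.
move=> r0 mA.
pose m' := mscale (NngNum (ltW r0)) (measure_function_pushforward__canonical__measure_function_Measure
    (@lebesgue_measure R) (measurable_scaleR r)).
rewrite [LHS](lebesgue_measure_unique (mu := m'))// {A mA} => _ [[a b] _ <-].
rewrite -[RHS]/(r%:E * lebesgue_measure (scaleR r @^-1` `]a, b])).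
rewrite (_ : _ @^-1` _ = `](r^-1 * a)%R, (r^-1 * b)%R]%classic); last first.
  apply/seteqP; split => x /=; rewrite !in_itv/= /scaleR;
  by rewrite ltr_pdivrMl// ler_pdivlMl.
rewrite !lebesgue_measure_itv/= !lte_fin ltr_pM2l ?invr_gt0//.
case: ifPn => _; last by rewrite mule0.
by rewrite -!EFinB -EFinM -mulrBr mulrA divff ?mul1r// gt_eqF.
Qed.

Lemma measurable_scale_rV n (r : R) :
  measurable_fun setT (fun x : 'rV[R]_n => r *: x).
Proof.
apply: measurable_fun_rVP => i.
rewrite (_ : _ \o _ = scaleR r \o @rV_coord R n i); last first.
  by apply/funext => x; rewrite /= /rV_coord mxE.
by apply: measurableT_comp; [exact: measurable_scaleR|exact: measurable_rV_coord].
Qed.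

(** By induction on n: the scaled measure agrees with the product measure on
rectangles, which determines it. *)
Lemma lebesgue_rV_scale n (r : R) (A : set 'rV[R]_n) : (0 < r)%R -> measurable A ->
  lebesgue_rV n A = (r ^+ n)%:E * lebesgue_rV n ((fun x => r *: x) @^-1` A).
Proof.
move=> r0; elim: n A => [|n IH] A mA.
  rewrite expr0 mul1e (_ : _ @^-1` A = A)//; apply/seteqP; split => x /=.
    by rewrite (_ : r *: x = x)//; apply/rowP => -[].
  by rewrite (_ : r *: x = x)//; apply/rowP => -[].
pose S (z : measurableTypeR R * 'rV[R]_n) : measurableTypeR R * 'rV[R]_n :=
  (scaleR r z.1, r *: z.2).
have mS : measurable_fun setT S.
  apply/measurable_fun_pairP; split.
    by apply: (measurableT_comp (measurable_scaleR r)); exact: measurable_fst.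
  by apply: (measurableT_comp (measurable_scale_rV r)); exact: measurable_snd.
pose prod := (@lebesgue_measure R \x lebesgue_rV n).
pose m' := mscale (NngNum (ltW (exprn_gt0 n.+1 r0)))
  (measure_function_pushforward__canonical__measure_function_Measure prod mS).
have mcons : measurable (@rV_cons R n @^-1` A).
  by rewrite -[X in measurable X]setTI; exact: measurable_rV_cons.
rewrite [LHS]/= /lebesgue_rV_step /pushforward.
rewrite (@product_measure_unique _ _ _ _ _ _ _ m')//; last first.
  move=> B C mB mC.
  rewrite -[LHS]/((r ^+ n.+1)%:E * prod (S @^-1` (B `*` C))).
  have -> : S @^-1` (B `*` C) = (scaleR r @^-1` B) `*` ((fun x => r *: x) @^-1` C).
    by apply/seteqP; split.
  rewrite /prod product_measure1E; last 2 first.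
  - by rewrite -[X in measurable X]setTI; exact: measurable_scaleR.
  - by rewrite -[X in measurable X]setTI; exact: measurable_scale_rV.
  rewrite -[RHS]/(@lebesgue_measure R B * lebesgue_rV n C).
  by rewrite (lebesgue_measure_scale r0 mB) (IH _ mC) exprS EFinM muleACA.
rewrite -[LHS]/((r ^+ n.+1)%:E * prod (S @^-1` (@rV_cons R n @^-1` A))); congr (_ * prod _).
apply/seteqP; split => z /=; rewrite (_ : rV_cons (S z) = r *: rV_cons z)//;
  apply/rowP => i; rewrite !mxE; by case: split_ordP => j _; rewrite !mxE.
Qed.

Lemma measurable_unit_box n :
  measurable [set x : 'rV[R]_n | forall i, (`|x ord0 i| <= 1)%R].
Proof.
have mI : measurable (`[(-1)%R, 1%R] : set (measurableTypeR R)) by exact: measurable_itv.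
rewrite (_ : [set _ | _] = \bigcap_i (@rV_coord R n i @^-1` `[(-1)%R, 1%R])).
  apply: fin_bigcap_measurable => // i _.
  by rewrite -[X in measurable X]setTI; exact: measurable_rV_coord.
apply/seteqP; split => x /= H i; move: (H i);
  by rewrite /rV_coord /= in_itv/= ler_norml// => /(_ I).
Qed.

Lemma lebesgue_rV_unit_box n :
  lebesgue_rV n [set x : 'rV[R]_n | forall i, (`|x ord0 i| <= 1)%R] < +oo.
Proof.
have meas := measurable_unit_box.
elim: n => [|n IH]; first by rewrite /= diracE; case: (_ \in _); rewrite ltry.
rewrite [ltLHS]/= /lebesgue_rV_step /pushforward.
apply: (@le_lt_trans _ _ ((@lebesgue_measure R \x lebesgue_rV n)
   (`[(-1)%R, 1%R]%classic `*` [set x : 'rV[R]_n | forall i, (`|x ord0 i| <= 1)%R]))).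
  apply: le_measure; rewrite ?inE.
  - by rewrite -[X in measurable X]setTI; apply: measurable_rV_cons => //; exact: meas.
  - by apply: measurableX; [exact: measurable_itv|exact: meas].
  - move=> [a y] /= H; split.
      by rewrite /= in_itv/= -ler_norml -[a](@rV_cons0 R n (a, y)); exact: H.
    by move=> i; rewrite -[y ord0 i](@rV_consS R n (a, y)); exact: H.
rewrite product_measure1E; [|exact: measurable_itv|exact: meas].
rewrite lte_mul_pinfty//.
  rewrite (_ : _ `[(-1)%R, 1%R]%classic = @lebesgue_measure R `[(-1)%R, 1%R])//.
  by rewrite lebesgue_measure_itv/=; case: ifPn.
Qed.

Definition unit_ball_volume n : R :=
  fine (lebesgue_rV n [set x : 'rV[R]_n | (enorm x <= 1)%R]).

Lemma unit_ball_volume_ge0 n : (0 <= unit_ball_volume n)%R.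
Proof. exact: fine_ge0. Qed.

Lemma lebesgue_rV_unit_ball n :
  lebesgue_rV n [set x : 'rV[R]_n | (enorm x <= 1)%R] = (unit_ball_volume n)%:E.
Proof.
rewrite fineK// ge0_fin_numE//; apply: le_lt_trans (lebesgue_rV_unit_box n).
apply: le_measure; rewrite ?inE; first exact: measurable_enorm_ball.
  exact: measurable_unit_box.
by move=> x /= H i; exact: le_trans (coord_le_enorm x i) H.
Qed.

Lemma lebesgue_rV_ball n (r : R) : (0 < r)%R ->
  lebesgue_rV n [set x : 'rV[R]_n | (enorm x <= r)%R] = (r ^+ n * unit_ball_volume n)%:E.
Proof.
move=> r0; rewrite (lebesgue_rV_scale r0 (measurable_enorm_ball r)).
rewrite (_ : _ @^-1` _ = [set x : 'rV[R]_n | (enorm x <= 1)%R]).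
  by rewrite lebesgue_rV_unit_ball.
by apply/seteqP; split => x /=; rewrite enormZ gtr0_norm// -ler_pdivlMl// mulVf// gt_eqF.
Qed.

(** A difference of balls, and b^n - a^n <= n b^(n - 1) (b - a). The inner radius a
may be negative, so that a shell of given width near the origin needs no
truncation. *)
Lemma lebesgue_rV_shell n (a b : R) : (0 < b)%R -> (a <= b)%R -> (0 < n)%N ->
  lebesgue_rV n [set x : 'rV[R]_n | (a < enorm x <= b)%R] <=
  (unit_ball_volume n * n%:R * b ^+ n.-1 * (b - a))%:E.
Proof.
move=> b0 ab n0.
have V0 := unit_ball_volume_ge0 n.
have mball r := @measurable_enorm_ball R n r.
have mshell := @measurable_enorm_shell R n a b.
have [a0|a0] := leP a 0%R.
  apply: (@le_trans _ _ (lebesgue_rV n [set x : 'rV[R]_n | (enorm x <= b)%R])).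
    by apply: le_measure; rewrite ?inE// => x /= /andP[].
  rewrite lebesgue_rV_ball// lee_fin -[X in (b ^+ X)%R](prednK n0) exprSr.
  rewrite -!mulrA [leRHS]mulrC [leRHS](_ : _ = b ^+ n.-1 * ((n%:R * (b - a)) * unit_ball_volume n))%R; last by ring.
  rewrite ler_wpM2l ?exprn_ge0// ?(ltW b0)// ler_wpM2r//.
  apply: (@le_trans _ _ (b - a)%R); first by rewrite lerBrDr gerDl.
  by rewrite ler_peMl ?subr_ge0// ler1n.
rewrite enorm_shellE.
have fin : lebesgue_rV n [set x : 'rV[R]_n | (enorm x <= b)%R] < +oo.
  by rewrite lebesgue_rV_ball// ltry.
have -> : lebesgue_rV n ([set x | (enorm x <= b)%R] `\` [set x | (enorm x <= a)%R]) =
    lebesgue_rV n [set x | (enorm x <= b)%R] - lebesgue_rV n [set x | (enorm x <= a)%R].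
  rewrite -[X in _ - lebesgue_rV n X](setIidr (A := [set x | (enorm x <= b)%R])).
    exact: measureD.
  by move=> x /= h; exact: le_trans ab.
rewrite !lebesgue_rV_ball// -EFinB lee_fin -mulrBl subrXX.
rewrite [leRHS](_ : _ = ((b - a) * (n%:R * b ^+ n.-1)) * unit_ball_volume n)%R; last by ring.
rewrite ler_wpM2r// ler_wpM2l ?subr_ge0//.
apply: (@le_trans _ _ (\sum_(i < n) b ^+ n.-1)%R).
  apply: ler_sum => i _.
  have -> : (b ^+ n.-1 = b ^+ (n.-1 - i) * b ^+ i)%R.
    by rewrite -exprD subnK// -ltnS prednK.
  rewrite ler_wpM2l ?exprn_ge0 ?(ltW b0)//.
  by apply: lerXn2r; rewrite ?nnegrE//; exact: ltW.
by rewrite sumr_const card_ord mulr_natl.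
Qed.

End scaling.

(** * Integrals of exponential weights over sublevel sets *)

Section weighted_ball.
Context {R : realType}.

Lemma powR_le_expR (e k : R) : 0 <= e -> 0 < k ->
  exists2 C, 0 < C & forall x, 0 <= x -> (1 + x) `^ e <= C * expR (k * x).
Proof.
move=> e0 k0; have [->|en0] := eqVneq e 0.
  exists 1 => // x x0; rewrite powRr0 mul1r -expR0 ler_expR.
  by rewrite mulr_ge0// ltW.
have e_gt0 : 0 < e by rewrite lt0r en0.
pose A := e / k; have A0 : 0 < A by rewrite divr_gt0.
exists (expR (k + e * ln A)); first exact: expR_gt0.
move=> x x0; have x1 : 0 < 1 + x by rewrite ltr_pwDl.
rewrite /powR gt_eqF// -expRD ler_expR.
have -> : ln (1 + x) = ln ((1 + x) / A) + ln A.
  by rewrite -lnM ?posrE ?divr_gt0// divfK// gt_eqF.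
have : ln ((1 + x) / A) <= (1 + x) / A.
  have z0 : 0 < (1 + x) / A by rewrite divr_gt0.
  rewrite -ler_expR lnK ?posrE//.
  by apply: le_trans (expR_ge1Dx _); rewrite lerDr.
rewrite -(ler_pM2l e_gt0) => h.
have -> : k + e * ln A + k * x = e * ((1 + x) / A) + e * ln A.
  by rewrite /A; field; rewrite !gt_eqF.
by rewrite mulrDr lerD2r.
Qed.

(** For negative e this is 1 + s <= (1 + (s - j)) (1 + j). *)
Lemma powR_shift (e s j : R) : 0 <= j -> j <= s ->
  (1 + (s - j)) `^ e <= (1 + s) `^ e * (1 + j) `^ `|e|.
Proof.
move=> j0 js.
have a0 : 0 < 1 + (s - j) by rewrite ltr_pwDl// subr_ge0.
have b0 : 0 < 1 + s by rewrite ltr_pwDl// (le_trans j0).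
have c0 : 0 < 1 + j by rewrite ltr_pwDl.
rewrite /powR !gt_eqF// -expRD ler_expR.
have l0 : 0 <= ln (1 + j) by rewrite ln_ge0// lerDl.
have h1 : ln (1 + (s - j)) <= ln (1 + s).
  by rewrite ler_ln ?posrE//; lra.
have h2 : ln (1 + s) <= ln (1 + (s - j)) + ln (1 + j).
  rewrite -lnM ?posrE// ler_ln ?posrE ?mulr_gt0//.
  have : 0 <= (s - j) * j by rewrite mulr_ge0// subr_ge0.
  by move=> ?; rewrite (_ : (1 + (s - j)) * (1 + j) = 1 + s + (s - j) * j); [lra|ring].
have [e0|e0] := leP 0 e.
  have : e * ln (1 + (s - j)) <= e * ln (1 + s) by rewrite ler_wpM2l.
  by move=> /le_trans; apply; rewrite lerDl mulr_ge0.
have : (- e) * ln (1 + s) <= (- e) * (ln (1 + (s - j)) + ln (1 + j)).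
  by rewrite ler_wpM2l// oppr_ge0 ltW.
by rewrite (ltr0_norm e0) mulrDr; lra.
Qed.

Lemma geometric_sum_le (r : R) k : 0 <= r -> r < 1 ->
  \sum_(i < k) r ^+ i <= (1 - r)^-1.
Proof.
move=> r0 r1; have d0 : 0 < 1 - r by rewrite subr_gt0.
rewrite -[leRHS]mul1r ler_pdivlMr// mulrC -opprB mulNr -subrX1 opprB.
by rewrite gerBl exprn_ge0.
Qed.

Variable n : nat.
Hypothesis n0 : (0 < n)%N.
Variables (Phi : R -> R) (delta : R).
Hypothesis delta0 : 0 < delta.
Hypothesis Phi0 : Phi 0 = 0.
Hypothesis PhiL : forall r r', 0 <= r -> r <= r' ->
  delta * (r' - r) <= Phi r' - Phi r <= delta^-1 * (r' - r).
Hypothesis mPhi : measurable_fun [set: 'rV[R]_n] (fun x : 'rV[R]_n => Phi (enorm x)).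

Let mu := @lebesgue_rV R n.
Let V := unit_ball_volume (R := R) n.

Lemma measurable_sublevel s : measurable [set x : 'rV[R]_n | Phi (enorm x) <= s].
Proof.
rewrite (_ : [set _ | _] = (fun x => Phi (enorm x)) @^-1` `]-oo, s]).
  rewrite -[X in measurable X]setTI.
  by apply: mPhi => //; exact: measurable_itv.
by apply/seteqP; split => x /=; rewrite in_itv.
Qed.

Definition shell y : set 'rV[R]_n := [set x | y - 1 < Phi (enorm x) <= y].

Lemma measurable_shell y : measurable (shell y).
Proof.
rewrite (_ : shell y = [set x | Phi (enorm x) <= y] `\` [set x | Phi (enorm x) <= y - 1]).
  by apply: measurableD; exact: measurable_sublevel.
apply/seteqP; split => x /=.
  by move=> /andP[h1 h2]; split => //; apply/negP; rewrite -ltNge.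
by move=> [h1 /negP]; rewrite -ltNge /shell/= => ->.
Qed.

(** As Phi is bi-Lipschitz, a layer on which Phi varies by 1 lies in a Euclidean
shell of bounded width, of radius at most comparable to 1 + y. *)
Lemma shell_mass : exists2 C, 0 < C & forall y, 0 <= y ->
  (mu (shell y) <= (C * (1 + y) ^+ n.-1)%:E)%E.
Proof.
have V0 : 0 <= V := unit_ball_volume_ge0 n.
pose C := (V * n%:R * delta^-1 ^+ n.-1 * (3 / delta)).
exists (C + 1).
  by rewrite ltr_pwDr// !mulr_ge0// ?exprn_ge0// ?invr_ge0 ltW.
move=> y y0.
suff : (mu (shell y) <= (C * (1 + y) ^+ n.-1)%:E)%E.
  move=> /le_trans; apply; rewrite lee_fin ler_wpM2r ?lerDl// exprn_ge0// addr_ge0//.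
have [[x0 /andP[yx0 x0y]]|E] := pselect (exists x, shell y x); last first.
  rewrite (_ : shell y = set0) ?measure0 ?lee_fin; last first.
    by apply/seteqP; split => // x xy; apply: E; exists x.
  rewrite !mulr_ge0// ?exprn_ge0// ?invr_ge0 ?(ltW delta0)// addr_ge0//.
pose r0 := enorm x0; have r00 : 0 <= r0 := enorm_ge0 x0.
have di0 : 0 < delta^-1 by rewrite invr_gt0.
have mul_le (r : R) : delta * r <= 1 -> r <= delta^-1.
  by rewrite -[_ <= delta^-1](ler_pM2l delta0) divff// gt_eqF.
(* The Euclidean shell is open at its inner radius, hence the factor 2. *)
have sub : shell y `<=` [set x | r0 - 2 * delta^-1 < enorm x <= r0 + delta^-1].
  move=> x /andP[h1 h2] /=; have x_0 := enorm_ge0 x.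
  have [xr|xr] := leP (enorm x) r0.
    have /andP[h3 _] := PhiL x_0 xr.
    have : r0 - enorm x <= delta^-1 by apply: mul_le; rewrite -/r0 in yx0 x0y; lra.
    lra.
  have /andP[h3 _] := PhiL r00 (ltW xr).
  have : enorm x - r0 <= delta^-1 by apply: mul_le; rewrite -/r0 in yx0 x0y; lra.
  lra.
have b0 : 0 < r0 + delta^-1 by lra.
have ab : r0 - 2 * delta^-1 <= r0 + delta^-1 by lra.
have r0y : r0 <= delta^-1 * y.
  have /andP[h3 _] := PhiL (lexx 0) r00.
  rewrite -[_ <= _](ler_pM2l delta0) mulrA divff ?gt_eqF// mul1r.
  by rewrite Phi0 !subr0 in h3; exact: le_trans x0y.
have mshell' := @measurable_enorm_shell R n (r0 - 2 * delta^-1) (r0 + delta^-1).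
apply: le_trans (le_measure _ _ _ sub) _; rewrite ?inE//; first exact: measurable_shell.
apply: le_trans (lebesgue_rV_shell b0 ab n0) _; rewrite lee_fin -/V.
rewrite (_ : C * _ = V * n%:R * (delta^-1 * (1 + y)) ^+ n.-1 * (3 / delta)); last first.
  by rewrite /C exprMn; ring.
rewrite (_ : r0 + delta^-1 - _ = 3 / delta); last by ring.
rewrite ler_wpM2r ?divr_ge0 ?(ltW delta0)// ler_wpM2l ?mulr_ge0//.
by apply: lerXn2r; rewrite ?nnegrE; lra.
Qed.

(** The sublevel set is cut into the layers s - j - 1 < Phi <= s - j. On layer j the
weight is of order (1 + s - j)^(- gam) exp(k (s - j)), so that it contributes
(1 + s - j)^(n - 1 - gam) exp(k (s - j)). Half of the exponential decay in j pays
for replacing s - j by s in the power, the other half sums the series. *)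
Lemma weighted_sublevel_bound (l gam k C0 : R) : 0 < l -> 0 <= gam -> 0 < k -> 0 <= C0 ->
  exists2 C, 0 < C & forall psi : 'rV[R]_n -> R, measurable_fun setT psi ->
  (forall x, 0 <= psi x) ->
  (forall x, psi x <= C0 * japanese (l * enorm x) `^ (- gam) * expR (k * Phi (enorm x))) ->
  forall s, 0 <= s ->
  (\int[mu]_(x in [set x | (Phi (enorm x) <= s)%R]) (psi x)%:E <=
    (C * (1 + s) `^ (n%:R - 1 - gam) * expR (k * s))%:E)%E.
Proof.
move=> l0 gam0 k0 C00; have [C1 C10 HC1] := shell_mass.
pose e : R := n%:R - 1 - gam.
have [C2 C20 HC2] := powR_le_expR (normr_ge0 e) (divr_gt0 k0 (ltr0Sn _ 1)).
have di0 : 0 < delta^-1 by rewrite invr_gt0.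
pose B := (2 + (delta * l)^-1).
have dl0 : 0 < (delta * l)^-1 by rewrite invr_gt0 mulr_gt0.
have B0 : 0 < B by rewrite /B; lra.
pose rho := expR (- (k / 2)).
have rho1 : rho < 1 by rewrite expR_lt1 oppr_lt0 divr_gt0.
have rho0 : 0 < rho by exact: expR_gt0.
pose CB := C0 * B `^ gam.
have CB0 : 0 <= CB by rewrite mulr_ge0// powR_ge0.
have i0 : 0 <= (1 - rho)^-1 by rewrite invr_ge0 subr_ge0 ltW.
exists (CB * C1 * C2 * (1 - rho)^-1 + 1).
  rewrite ltr_pwDr//; apply: mulr_ge0 => //.
  by apply: mulr_ge0; [apply: mulr_ge0 => //|]; exact: ltW.
move=> psi mpsi psi0 psiB s s0.
have pt y x : 0 <= y -> shell y x -> psi x <= CB * (1 + y) `^ (- gam) * expR (k * y).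
  move=> y0 /andP[h1 h2]; apply: le_trans (psiB x) _.
  have x_0 := enorm_ge0 x.
  have /andP[_ h3] := PhiL (lexx 0) x_0; rewrite Phi0 !subr0 in h3.
  have jap1 : 1 <= japanese (l * enorm x).
    by rewrite -[leLHS]sqrtr1 ler_wsqrtr// lerDl sqr_ge0.
  have jap2 : l * enorm x <= japanese (l * enorm x).
    rewrite -[leLHS]ger0_norm; last by rewrite mulr_ge0// ltW.
    by rewrite -sqrtr_sqr ler_wsqrtr// lerDr.
  have jap : 1 + y <= B * japanese (l * enorm x).
    have : delta^-1 * enorm x <= (delta * l)^-1 * japanese (l * enorm x).
      rewrite (_ : delta^-1 * _ = (delta * l)^-1 * (l * enorm x)).
        by rewrite ler_pM2l.
      by field; rewrite !gt_eqF.
    rewrite /B mulrDl; lra.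
  have jap0 : 0 < japanese (l * enorm x) by lra.
  apply: ler_pM; rewrite ?expR_ge0 ?mulr_ge0 ?powR_ge0//; last first.
    by rewrite ler_expR ler_pM2l.
  rewrite /CB -mulrA ler_wpM2l//.
  rewrite !powRN ler_pdivlMr ?powR_gt0//; last lra.
  rewrite mulrC ler_pdivrMr ?powR_gt0//.
  rewrite -powRM ?(ltW B0) ?(ltW jap0)//.
  by rewrite ge0_ler_powR// nnegrE; [lra|apply: mulr_ge0; exact: ltW].
clearbody CB.
(* The layers j < J are those with s - j >= 0; they cover the sublevel set, since
Phi >= 0. *)
pose J := (Num.truncn s).+1.
pose y (j : nat) : R := s - j%:R.
have y0 (j : 'I_J) : 0 <= y j.
  rewrite subr_ge0; have := ltn_ord j; rewrite ltnS => jJ.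
  by have /andP[h _] := truncn_itv s0; apply: le_trans h; rewrite ler_nat.
pose c (j : nat) := CB * (1 + y j) `^ (- gam) * expR (k * y j).
have c0 j : 0 <= c j by rewrite /c !mulr_ge0 ?powR_ge0 ?expR_ge0.
apply: (@le_trans _ _ (\int[mu]_x (\sum_(j < J) (c j * \1_(shell (y j)) x)%:E))%E).
  rewrite integral_mkcond; apply: ge0_le_integral => //.
  - by move=> x _; rewrite patchE; case: ifPn => // _; rewrite lee_fin.
  - apply/(measurable_restrictT _ _).1.
      exact: measurable_sublevel.
    by apply/measurable_EFinP; apply: measurable_funTS.
  - apply: emeasurable_sum => j; apply/measurable_EFinP.
    by apply: measurable_funM => //; exact: measurable_indic (measurable_shell _).
  move=> x _; rewrite patchE; case: ifPn => [|_]; last first.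
    by rewrite sume_ge0// => j _; rewrite lee_fin mulr_ge0.
  rewrite inE /= => xs.
  have px : 0 <= Phi (enorm x).
    have /andP[h _] := PhiL (lexx 0) (enorm_ge0 x).
    by rewrite Phi0 !subr0 in h; apply: le_trans h; rewrite mulr_ge0 ?enorm_ge0// ltW.
  have d0 : 0 <= s - Phi (enorm x) by rewrite subr_ge0.
  pose j := Num.truncn (s - Phi (enorm x)).
  have /andP[j1 j2] : j%:R <= s - Phi (enorm x) < j.+1%:R.
    exact: truncn_itv.
  have jJ : (j < J)%N.
    by rewrite ltnS truncn_ge_nat//; apply: le_trans j1 _; lra.
  have xj : shell (y j) x by rewrite /shell /y /=; rewrite -natr1 in j2; apply/andP; split; lra.
  rewrite (bigD1 (Ordinal jJ))//= indicE mem_set// mulr1.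
  apply: (@le_trans _ _ (c j)%:E); last first.
    by rewrite leeDl// sume_ge0// => i _; rewrite lee_fin mulr_ge0.
  by rewrite lee_fin; apply: pt => //; exact: (y0 (Ordinal jJ)).
rewrite ge0_integral_sum//; last 2 first.
- move=> j; apply/measurable_EFinP.
  by apply: measurable_funM => //; exact: measurable_indic (measurable_shell _).
- by move=> j x _; rewrite lee_fin mulr_ge0.
apply: (@le_trans _ _ (\sum_(j < J) (c j * (C1 * (1 + y j) ^+ n.-1))%:E)%E).
  apply: lee_sum => j _; under eq_integral do rewrite EFinM.
  rewrite ge0_integralZl//; last 2 first.
  - by apply/measurable_EFinP; exact: measurable_indic (measurable_shell _).
  - by rewrite lee_fin.
  rewrite integral_indic ?setIT//; last exact: measurable_shell.
  rewrite (EFinM (c j) (C1 * _)); apply: lee_wpmul2l; rewrite ?lee_fin//.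
  exact: HC1.
rewrite sumEFin lee_fin.
apply: (@le_trans _ _ (\sum_(j < J) (CB * C1 * C2 * (1 + s) `^ e * expR (k * s)) * rho ^+ j)).
  apply: ler_sum => j _.
  have yj := y0 j; have y1 : 0 < 1 + y j by lra.
  have -> : c j * (C1 * (1 + y j) ^+ n.-1) = CB * C1 * ((1 + y j) `^ e * expR (k * y j)).
    have -> : (1 + y j) `^ e = (1 + y j) `^ (- gam) * (1 + y j) ^+ n.-1.
      rewrite -powR_mulrn ?(ltW y1)// -powRD; last by apply/implyP => _; rewrite gt_eqF.
      have en : n%:R = n.-1%:R + 1 :> R by rewrite natr1 prednK.
      by congr (_ `^ _); rewrite /e en; ring.
    by rewrite /c; ring.
  rewrite -!mulrA ler_wpM2l// ler_wpM2l ?(ltW C10)//.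
  have j0 : 0 <= j%:R :> R by [].
  have js : j%:R <= s by have := yj; rewrite /y subr_ge0.
  apply: le_trans (ler_wpM2r (expR_ge0 _) (powR_shift e j0 js)) _.
  have -> : expR (k * y j) = expR (k * s) * expR (- (k * j%:R)).
    by rewrite -expRD /y; congr expR; ring.
  have -> : rho ^+ j = expR (k / 2 * j%:R) * expR (- (k * j%:R)).
    by rewrite /rho -expRM_natl -expRD; congr expR; field.
  rewrite [leLHS](_ : _ = (1 + s) `^ e * expR (k * s) * expR (- (k * j%:R)) * (1 + j%:R) `^ `|e|); last by ring.
  rewrite [leRHS](_ : _ = (1 + s) `^ e * expR (k * s) * expR (- (k * j%:R)) * (C2 * expR (k / 2 * j%:R))); last by ring.
  rewrite ler_wpM2l ?mulr_ge0 ?powR_ge0 ?expR_ge0//.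
  exact: HC2.
rewrite -mulr_sumr -/e.
rewrite [leRHS](_ : _ = (CB * C1 * C2 * (1 - rho)^-1 + 1) * ((1 + s) `^ e * expR (k * s))); last by ring.
rewrite [leLHS](_ : _ = (CB * C1 * C2 * (\sum_(i < J) rho ^+ i)) * ((1 + s) `^ e * expR (k * s))); last by ring.
rewrite ler_wpM2r ?mulr_ge0 ?powR_ge0 ?expR_ge0//.
apply: (@le_trans _ _ (CB * C1 * C2 * (1 - rho)^-1)); last by rewrite lerDl.
rewrite ler_wpM2l ?mulr_ge0 ?(ltW C10) ?(ltW C20)//.
by apply: geometric_sum_le => //; exact: ltW.
Qed.

End weighted_ball.

(** * Smooth cutoff functions *)

Section flat_functions.
Context {R : realType}.
Implicit Types P Q : {poly R}.

(** For P = 1 this is exp(-1/y) continued by 0. The polynomial factor makes the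
family stable under differentiation. *)
Definition flat P (y : R) : R := if 0 < y then P.[y^-1] * expR (- y^-1) else 0.

Lemma poly_le_expR P : exists2 C, 0 <= C & forall w, 0 <= w -> `|P.[w]| <= C * expR w.
Proof.
exists (\sum_(i < size P) `|P`_i| * i`!%:R).
  by apply: sumr_ge0 => i _; rewrite mulr_ge0.
move=> w w0; rewrite horner_coef mulr_suml.
apply: le_trans (ler_norm_sum _ _ _) _; apply: ler_sum => i _.
rewrite normrM -mulrA ler_wpM2l// ger0_norm ?exprn_ge0//.
case: (i : nat) => [|k].
  by rewrite expr0 fact0 mul1r -expR0 ler_expR.
rewrite -ler_pdivrMl ?ltr0n ?fact_gt0// mulrC.
by apply: le_trans (expR_ge1Dxn k w0); rewrite lerDr.
Qed.

(** The exponential absorbs every power of 1/y; two of them suffice for the function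
to be differentiable with derivative 0 at the gluing point. *)
Lemma flat_le_sqr P : exists2 C, 0 <= C & forall y, `|flat P y| <= C * y ^+ 2.
Proof.
have [C C0 HC] := poly_le_expR (P * 'X^2); exists C => // y; rewrite /flat.
case: ifPn => [y0|_]; last by rewrite normr0 mulr_ge0// sqr_ge0.
have w0 : 0 <= y^-1 by rewrite invr_ge0 ltW.
have := HC _ w0; rewrite hornerM hornerXn normrM (ger0_norm (exprn_ge0 2 w0)) => h.
rewrite normrM (ger0_norm (expR_ge0 _)) expRN ler_pdivrMr ?expR_gt0//.
rewrite -[leRHS]mulrA [y ^+ 2 * _]mulrC mulrA -ler_pdivrMr ?exprn_gt0//.
by rewrite -exprVn.
Qed.

Lemma is_derive_flat P (y : R) :
  is_derive y (1 : R) (flat P) (flat ('X^2 * (P - P^`())) y).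
Proof.
have [y0|y0] := ltP 0 y.
  have near_y : \near y, P.[y^-1] * expR (- y^-1) = flat P y.
    have : nbhs y [set z | 0 < z] by apply: open_nbhs_nbhs; split => //; exact: open_gt.
    by apply: filterS => z /= z0; rewrite /flat z0.
  apply: (near_eq_is_derive near_y).
  have dV : is_derive y 1 (fun z : R => z^-1) (- y ^- 2 *: 1).
    by apply: is_deriveV; rewrite ?gt_eqF.
  have dN : is_derive y 1 (fun z : R => - z^-1) (- (- y ^- 2 *: 1)).
    exact: is_deriveN.
  have d1 := @is_derive1_comp _ (horner P) _ y _ _ _ dV.
  have d2 := @is_derive1_comp _ expR _ y _ _ (is_derive_expR _) dN.
  have := is_deriveM (d1 _ (is_derive_poly _ _)) d2.
  move=> /is_derive_eq; apply.
  rewrite /flat y0 hornerM hornerXn hornerD hornerN /= /GRing.scale /= -exprVn; ring.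
have [C C0 HC] := flat_le_sqr P.
have F0 : flat P y = 0 by rewrite /flat ltNge y0.
have Q0 : flat ('X^2 * (P - P^`())) y = 0 by rewrite /flat ltNge y0.
have H : (fun h => h^-1 *: ((flat P \o shift y) (h *: 1) - flat P y)) @ 0^' --> 0.
  rewrite F0; apply/cvgr0Pnorm_le => e e0.
  have : \forall h \near (0 : R)^', C * `|h| <= e.
    have [->|Cn0] := eqVneq C 0; first by apply: nearW => h; rewrite mul0r ltW.
    have C1 : 0 < C by rewrite lt0r Cn0.
    have eC : 0 < C^-1 * e by rewrite mulr_gt0 ?invr_gt0.
    by apply: filterS (dnbhs0_le eC) => h; rewrite ler_pdivlMl.
  apply: filterS => h hC /=; rewrite subr0 [_ *: 1]mulr1 normrM normfV.
  have [yh|yh] := ltP 0 (h + y); last by rewrite /flat ltNge yh normr0 mulr0 ltW.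
  have h0 : 0 < h by apply: lt_le_trans yh _; rewrite gerDl.
  rewrite (gtr0_norm h0) in hC *; rewrite ler_pdivrMl// mulrC; apply: le_trans (HC _) _.
  apply: le_trans (ler_wpM2r (ltW h0) hC).
  rewrite -mulrA -expr2 ler_wpM2l//; apply: lerXn2r; rewrite ?nnegrE ?gerDl//; exact: ltW.
apply: DeriveDef; first by apply/cvg_ex; exists 0.
by rewrite Q0; apply: cvg_lim.
Qed.

End flat_functions.

Section smooth_calculus.
Context {R : realType} {n : nat}.
Implicit Types f g : 'rV[R]_n -> R.

Lemma Ck_continuous k f : Ck k f -> continuous f.
Proof. by case: k => [|k] []. Qed.

Lemma CkS k f : Ck k.+1 f -> Ck k f.
Proof.
elim: k f => [|k IH] f [cf [df Cf]]; first by split.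
by split => //; split => // i; exact: IH.
Qed.

Lemma Ck_cst k (a : R) : Ck k (fun _ : 'rV[R]_n => a).
Proof.
elim: k a => [|k IH] a; first by split => //; exact: cst_continuous.
split; first exact: cst_continuous.
split => [i x|i]; first exact: derivable_cst.
rewrite (_ : partial i _ = fun _ => 0); first exact: IH.
by apply/funext => x; exact: derive_cst.
Qed.

Lemma CkD k f g : Ck k f -> Ck k g -> Ck k (fun x => f x + g x).
Proof.
elim: k f g => [|k IH] f g /=.
  by move=> [cf _] [cg _]; split => // x; apply: continuousD; [exact: cf|exact: cg].
move=> [cf [df Cf]] [cg [dg Cg]]; split.
  by move=> x; apply: continuousD; [exact: cf|exact: cg].
split => [i x|i]; first exact: derivableD.
rewrite (_ : partial i _ = fun x => partial i f x + partial i g x).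
  by apply: IH; [exact: Cf|exact: Cg].
by apply/funext => x; exact: deriveD.
Qed.

Lemma CkM k f g : Ck k f -> Ck k g -> Ck k (fun x => f x * g x).
Proof.
elim: k f g => [|k IH] f g.
  by move=> [cf _] [cg _]; split => // x; apply: continuousM; [exact: cf|exact: cg].
move=> Cf' Cg'; have Cf0 := CkS Cf'; have Cg0 := CkS Cg'.
move: Cf' Cg' => [cf [df Cf]] [cg [dg Cg]]; split.
  by move=> x; apply: continuousM; [exact: cf|exact: cg].
split => [i x|i]; first exact: derivableM.
rewrite (_ : partial i _ = fun x => f x * partial i g x + g x * partial i f x).
  by apply: CkD; apply: IH => //; [exact: Cg|exact: Cf].
by apply/funext => x; exact: deriveM.
Qed.

Lemma CkV k f : (forall x, f x != 0) -> Ck k f -> Ck k (fun x => (f x)^-1).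
Proof.
move=> f0; elim: k f f0 => [|k IH] f f0.
  by move=> [cf _]; split => // x; apply: continuousV; [exact: f0|exact: cf].
move=> Cf'; have Cf0 := CkS Cf'; move: Cf' => [cf [df Cf]]; split.
  by move=> x; apply: continuousV; [exact: f0|exact: cf].
split => [i x|i]; first exact: derivableV.
rewrite (_ : partial i _ = fun x => -1 * ((f x)^-1 * (f x)^-1) * partial i f x).
  apply: CkM; last exact: Cf.
  by apply: CkM; [exact: Ck_cst|apply: CkM; exact: IH].
by apply/funext => x; rewrite /partial deriveV// /GRing.scale/= -exprVn expr2; ring.
Qed.

Lemma Ck_prod (I : Type) (s : seq I) k (F : I -> 'rV[R]_n -> R) :
  (forall i, Ck k (F i)) -> Ck k (fun x => \prod_(i <- s) F i x).
Proof.
move=> CF; elim: s => [|i s IH].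
  by rewrite (_ : (fun _ => _) = fun _ => 1); [exact: Ck_cst|apply/funext => x; rewrite big_nil].
rewrite (_ : (fun _ => _) = fun x => F i x * \prod_(j <- s) F j x); first exact: CkM.
by apply/funext => x; rewrite big_cons.
Qed.

Lemma is_derive_line f x v (l : R) :
  is_derive (0 : R) (1 : R) (fun t : R => f (t *: v + x)) l -> is_derive x v f l.
Proof.
move=> [d <-]; apply: DeriveDef; first by apply/derivable1P.
rewrite /derive; set g1 := fun h => h^-1 *: _; set g2 := fun h => h^-1 *: _.
suff -> : g1 = g2 by [].
by apply/funext => t; rewrite /g1 /g2 /= addr0 scale0r add0r [_%:A]mulr1.
Qed.

Lemma is_derive_coord (h : R -> R) (d a b : R) (x : 'rV[R]_n) i j :
  is_derive (a * x ord0 i + b) (1 : R) h d ->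
  is_derive x (delta_mx ord0 j) (fun y : 'rV[R]_n => h (a * y ord0 i + b))
    ((i == j)%:R * a * d).
Proof.
move=> hd; apply: is_derive_line.
pose e : R := (i == j)%:R.
rewrite (_ : (fun t => _) = h \o (fun t : R => (a * e) * t + (a * x ord0 i + b))); last first.
  apply/funext => t /=; congr h; rewrite !mxE eqxx /=.
  by rewrite mulrDr addrA; congr (_ + _ + _); rewrite -/e; ring.
have d1 : is_derive (0 : R) (1 : R) (fun t : R => (a * e) * t + (a * x ord0 i + b)) (a * e).
  have := is_deriveD (is_deriveZ (a * e) (is_derive_id (0 : R) (1 : R)))
    (is_derive_cst (a * x ord0 i + b) (0 : R) (1 : R)).
  by move=> /is_derive_eq; apply; rewrite addr0 [LHS]mulr1.
have hd' : is_derive ((a * e) * 0 + (a * x ord0 i + b)) (1 : R) h d.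
  by rewrite mulr0 add0r.
have := @is_derive1_comp _ h (fun t : R => a * e * t + (a * x ord0 i + b)) 0 _ _ hd' d1.
by move=> /is_derive_eq; apply; rewrite -/e; ring.
Qed.

Lemma Ck_flat_coord k P (a b : R) (i : 'I_n) :
  Ck k (fun x : 'rV[R]_n => flat P (a * x ord0 i + b)).
Proof.
have cont Q : continuous (fun x : 'rV[R]_n => flat Q (a * x ord0 i + b)).
  move=> x; apply: (@continuous_comp _ _ _ (fun x : 'rV[R]_n => a * x ord0 i + b)).
    apply: continuousD; last exact: cst_continuous.
    by apply: continuousM; [exact: cst_continuous|exact: coord_continuous].
  apply: differentiable_continuous; apply/derivable1_diffP.
  exact: (@ex_derive _ _ _ _ _ _ _ (is_derive_flat Q _)).
elim: k P => [|k IH] P; first by split.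
split => //; split => [j x|j].
  exact: (@ex_derive _ _ _ _ _ _ _ (is_derive_coord j (is_derive_flat P _))).
rewrite (_ : partial j _ = fun x => (i == j)%:R * a *
    flat ('X^2 * (P - P^`())) (a * x ord0 i + b)).
  by apply: CkM; [exact: Ck_cst|exact: IH].
apply/funext => x.
exact: (@derive_val _ _ _ _ _ _ _ (is_derive_coord j (is_derive_flat P _))).
Qed.

End smooth_calculus.

Section cutoff.
Context {R : realType} {n : nat}.

Definition smooth_step (y : R) : R := flat 1 y / (flat 1 y + flat 1 (1 - y)).

Lemma flat1_ge0 (y : R) : 0 <= flat 1 y.
Proof. by rewrite /flat; case: ifPn => // _; rewrite hornerC mul1r expR_ge0. Qed.

Lemma flat1_gt0 (y : R) : 0 < y -> 0 < flat 1 y.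
Proof. by move=> y0; rewrite /flat y0 hornerC mul1r expR_gt0. Qed.

Lemma smooth_step_den_gt0 (y : R) : 0 < flat 1 y + flat 1 (1 - y).
Proof.
have [y0|y0] := ltP 0 y; first by rewrite ltr_pwDl ?flat1_gt0 ?flat1_ge0.
by rewrite ltr_pwDr ?flat1_ge0// flat1_gt0// subr_gt0 (le_lt_trans y0).
Qed.

Lemma smooth_step_ge0 (y : R) : 0 <= smooth_step y.
Proof. by rewrite divr_ge0 ?flat1_ge0// ltW// smooth_step_den_gt0. Qed.

Lemma smooth_step1 (y : R) : 1 <= y -> smooth_step y = 1.
Proof.
move=> y1; have := smooth_step_den_gt0 y; rewrite /smooth_step.
have -> : flat 1 (1 - y) = 0 by rewrite /flat ltNge subr_le0 y1.
by rewrite addr0 => /lt0r_neq0; exact: divff.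
Qed.

Lemma smooth_step0 (y : R) : y <= 0 -> smooth_step y = 0.
Proof. by move=> y0; rewrite /smooth_step {1}/flat ltNge y0 mul0r. Qed.

Lemma Ck_smooth_step_coord k (a b : R) (i : 'I_n) :
  Ck k (fun x : 'rV[R]_n => smooth_step (a * x ord0 i + b)).
Proof.
apply: CkM; first exact: Ck_flat_coord.
apply: CkV => [x|]; first by rewrite gt_eqF// smooth_step_den_gt0.
apply: CkD; first exact: Ck_flat_coord.
rewrite (_ : (fun _ => _) = fun x : 'rV[R]_n => flat 1 ((- a) * x ord0 i + (1 - b))).
  exact: Ck_flat_coord.
by apply/funext => x; congr flat; ring.
Qed.

(** A product over the coordinates is smooth on the whole space and depends on each
coordinate through an affine map only. *)
Definition cutoff (r : R) (x : 'rV[R]_n) : R :=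
  \prod_i (smooth_step (1 * x ord0 i + (r + 1)) * smooth_step (-1 * x ord0 i + (r + 1))).

Lemma smooth_cutoff r : smooth (cutoff r).
Proof. by move=> k; apply: Ck_prod => i; apply: CkM; exact: Ck_smooth_step_coord. Qed.

Lemma cutoff_ge0 r x : 0 <= cutoff r x.
Proof. by apply: prodr_ge0 => i _; rewrite mulr_ge0 ?smooth_step_ge0. Qed.

Lemma cutoff1 r x : enorm x <= r -> cutoff r x = 1.
Proof.
move=> xr; apply: big1 => i _; have := le_trans (coord_le_enorm x i) xr.
by rewrite ler_norml => /andP[h1 h2]; rewrite !smooth_step1 ?mulr1//; lra.
Qed.

Lemma cutoff0 r (x : 'rV[R]_n) i : r + 1 <= `|x ord0 i| -> cutoff r x = 0.
Proof.
move=> rx; rewrite /cutoff (bigD1 i)//= [X in X * _](_ : _ = 0) ?mul0r//.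
move: rx; rewrite ler_normr => /orP[h|h].
  by rewrite [X in _ * X]smooth_step0 ?mulr0//; lra.
by rewrite [X in X * _]smooth_step0 ?mul0r//; lra.
Qed.

Lemma test_function_cutoffM r (f : 'rV[R]_n -> R) : smooth f ->
  test_function (fun x => cutoff r x * f x).
Proof.
move=> sf; split; first by move=> k; apply: CkM => //; exact: smooth_cutoff.
pose B := [set v : 'rV[R]_n | forall i, v ord0 i \in `[- (r + 1), r + 1]].
have cB : compact B.
  by apply: (@rV_compact _ _ (fun=> `[- (r + 1), r + 1]%classic)) => _; exact: segment_compact.
apply: (subclosed_compact _ cB); first exact: closed_closure.
have clB : closed B by apply: compact_closed cB; exact: norm_hausdorff.
rewrite /closed_support closureE => x; apply; split => // y /=.
apply: contraNP => yB.
have [i yi] : exists i, ~~ (y ord0 i \in `[- (r + 1), r + 1]).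
  by apply: contrapT => h; apply: yB => i; apply/negPn/negP => ?; apply: h; exists i.
rewrite (@cutoff0 r y i) ?mul0r//; move: yi.
by rewrite in_itv/= -ler_norml -ltNge => /ltW.
Qed.

End cutoff.

(** * The radial distance and the volume density *)

Section radial.
Context {R : realType}.
Variables (K : R -> R) (delta : R).
Hypothesis delta0 : 0 < delta.
Hypothesis cK : {within `[0, +oo[, continuous K}.
Hypothesis KB : forall r, 0 <= r -> delta < K r /\ K r < delta^-1.

Let mu := @lebesgue_measure R.

Lemma integrable_radial (r : R) : mu.-integrable `[0, r] (EFin \o K).
Proof.
apply: continuous_compact_integrable; first exact: segment_compact.
apply: continuous_subspaceW cK => x /=; rewrite !in_itv/= andbT => /andP[]//.
Qed.

Lemma radial_int0 : radial_int K 0 = 0.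
Proof. by rewrite /radial_int set_itv1 Rintegral_set1. Qed.

Lemma radial_int_lipschitz (r r' : R) : 0 <= r -> r <= r' ->
  delta * (r' - r) <= radial_int K r' - radial_int K r <= delta^-1 * (r' - r).
Proof.
move=> r0 rr'; rewrite /radial_int Rintegral_itvB ?bnd_simp//; last exact: integrable_radial.
have mI : measurable (`]r, r'] : set (measurableTypeR R)) by exact: measurable_itv.
have len : fine (mu `]r, r']) = r' - r.
  rewrite /mu lebesgue_measure_itv/= lte_fin; case: ifPn => //.
  by rewrite -leNgt => ?; rewrite (@le_anti _ _ r r') ?rr'// subrr.
have iK : mu.-integrable `]r, r'] (EFin \o K).
  apply: integrableS (integrable_radial r') => //.
  by move=> x /=; rewrite !in_itv/= => /andP[h1 ->]; rewrite (le_trans r0 (ltW h1)).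
have icst (a : R) : mu.-integrable `]r, r'] (EFin \o cst a).
  have icst' : mu.-integrable `[0, r'] (EFin \o cst a).
    apply: continuous_compact_integrable; first exact: segment_compact.
    by apply: continuous_subspaceT => x; exact: cst_continuous.
  apply: integrableS icst' => //.
  by move=> x /=; rewrite !in_itv/= => /andP[h1 ->]; rewrite (le_trans r0 (ltW h1)).
have K0 x : `]r, r']%classic x -> delta < K x /\ K x < delta^-1.
  by rewrite /= in_itv/= => /andP[h1 _]; apply: KB; rewrite (le_trans r0 (ltW h1)).
apply/andP; split.
- rewrite -len -Rintegral_cst//; apply: le_Rintegral => //; first exact: icst.
  by move=> x /K0[/ltW].
- rewrite -len -Rintegral_cst//; apply: le_Rintegral => //; first exact: icst.
  by move=> x /K0[_ /ltW].
Qed.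

Lemma radial_int_ge (r : R) : 0 <= r -> delta * r <= radial_int K r.
Proof.
move=> r0; have /andP[h _] := radial_int_lipschitz (lexx 0) r0.
by rewrite radial_int0 !subr0 in h.
Qed.

Lemma measurable_radial_int n :
  measurable_fun [set: 'rV[R]_n] (fun x : 'rV[R]_n => radial_int K (enorm x)).
Proof.
apply: (measurableT_comp _ measurable_enorm).
apply: nondecreasing_measurable => // r r' rr'.
have [r0|r0] := leP 0 r.
  have /andP[h _] := radial_int_lipschitz r0 rr'.
  by rewrite -subr_ge0; apply: le_trans h; rewrite mulr_ge0 ?subr_ge0// ltW.
have -> : radial_int K r = 0.
  by rewrite /radial_int set_itv_ge ?Rintegral_set0// bnd_simp -ltNge.
have [r'0|r'0] := leP 0 r'.
  by apply: le_trans (radial_int_ge r'0); rewrite mulr_ge0// ltW.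
by rewrite /radial_int set_itv_ge ?Rintegral_set0// bnd_simp -ltNge.
Qed.

End radial.

Section density.
Context {R : realType} {n : nat}.
Variables (g : 'rV[R]_n -> 'M[R]_n) (delta : R).
Hypothesis delta0 : 0 < delta.
Hypothesis gsym : forall x, (g x)^T = g x.
Hypothesis gE : forall x xi, delta * enorm xi ^+ 2 <= quad (invmx (g x)) xi.

(** Let xi be the j-th row of g. The ellipticity bound for the inverse matrix gives
delta |xi|^2 <= g_jj <= |xi|, hence |xi| <= 1/delta. *)
Lemma metric_entry_le x j k : g x \in unitmx -> `|g x j k| <= delta^-1.
Proof.
move=> gu; pose e : 'rV[R]_n := delta_mx ord0 j.
have row_e i : (e *m g x) ord0 i = g x j i by rewrite -rowE mxE.
have q : quad (invmx (g x)) (e *m g x) = g x j j.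
  rewrite /quad -mulmxA -[e *m g x *m _]mulmxA mulKVmx ?trmx_mul//.
  by rewrite gsym mulmxA -rowE trmx_delta -colE !mxE.
have := gE x (e *m g x); rewrite q => h.
have h1 := le_trans (ler_norm _) (coord_le_enorm (e *m g x) j).
rewrite row_e in h1.
have h2 := coord_le_enorm (e *m g x) k; rewrite row_e in h2.
apply: le_trans h2 _.
have [->|nz] := eqVneq (enorm (e *m g x)) 0; first by rewrite invr_ge0 ltW.
have N0 : 0 < enorm (e *m g x) by rewrite lt0r nz enorm_ge0.
have := le_trans h h1; rewrite expr2 mulrA -[leRHS]mul1r ler_pM2r// => h3.
by rewrite -[leRHS]mul1r ler_pdivlMr// mulrC.
Qed.

Lemma vol_density_ge0 x : 0 <= vol_density g x.
Proof. exact: sqrtr_ge0. Qed.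

(** Where g is invertible its entries are bounded and the Leibniz formula bounds its
determinant; elsewhere the determinant is 0. *)
Lemma vol_density_bounded : exists2 D, 0 < D & forall x, vol_density g x <= D.
Proof.
exists (Num.sqrt (\sum_(s : 'S_n) \prod_(i < n) delta^-1) + 1).
  by rewrite ltr_pwDr// sqrtr_ge0.
move=> x; apply: (@le_trans _ _ (Num.sqrt (\sum_(s : 'S_n) \prod_(i < n) delta^-1))).
  apply: ler_wsqrtr.
  have [gu|] := boolP (g x \in unitmx); last first.
    rewrite unitmxE unitfE negbK => /eqP ->.
    by apply: sumr_ge0 => s _; apply: prodr_ge0 => i _; rewrite invr_ge0 ltW.
  apply: le_trans (ler_norm _) _; apply: le_trans (ler_norm_sum _ _ _) _.
  apply: ler_sum => s _; rewrite normrM normrX normrN1 expr1n mul1r normr_prod.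
  by apply: ler_prod => i _; rewrite normr_ge0 metric_entry_le.
by rewrite lerDl.
Qed.

Hypothesis gC : forall j k, continuous (fun x => g x j k).

Lemma continuous_vol_density : continuous (vol_density g).
Proof.
move=> x; apply: (@continuous_comp _ _ _ (fun x => \det (g x)) Num.sqrt); last exact: sqrt_continuous.
move: x; rewrite /determinant.
apply: (@continuous_big _ _ +%R 0 xpredT); first exact: add_continuous.
move=> s _ x; apply: (@continuousM _ _ (fun=> (-1) ^+ s) (fun x => \prod_i g x i (s i)) x); first exact: cst_continuous.
move: x; apply: (@continuous_big R^o _ *%R 1 xpredT mul_continuous _ _ (fun i x => g x i (s i))).
by move=> i _; exact: gC.
Qed.

Lemma measurable_vol_density : measurable_fun setT (vol_density g).
Proof. by apply: continuous_measurable_rV; exact: continuous_vol_density. Qed.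

End density.

(** * Derivatives in time and exponential growth *)

Section one_sided.
Context {R : realType}.
Implicit Types h : R -> R.

(** The difference quotient at t, completed by the value h' t, is continuous at t
within the interval: this gives the continuity of h, and Caratheodory's
criterion in the interior. *)
Lemma derivative_within_differentiable_on (T : \bar R) (S : R) h h' :
  0 < S -> (S%:E < T)%E ->
  derivative_within (time_interval T) h h' -> differentiable_on 0 S h h'.
Proof.
move=> S0 ST dh.
pose q t := fun s : R => if s == t then h' t else (h s - h t) / (s - t).
have qE t s : h s - h t = q t s * (s - t).
  rewrite /q; case: eqVneq => [->|st]; first by rewrite !subrr mulr0.
  by rewrite divfK// subr_eq0.
have TS t : 0 <= t -> t <= S -> time_interval T t.
  by move=> t0 tS; split => //; apply: le_lt_trans ST; rewrite lee_fin.
have qcvg t : time_interval T t -> q t @ within (time_interval T) (nbhs t) --> h' t.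
  move=> Tt N /[dup] N0 /(dh t Tt) H.
  have {}H : \forall s \near t, (time_interval T `\ t) s -> N ((h s - h t) / (s - t)) := H.
  change (\forall s \near t, time_interval T s -> N (q t s)).
  apply: filterS H => s Hs Ts; rewrite /q; case: eqVneq => [_|st].
    exact: nbhs_singleton N0.
  by apply: Hs; split => //; exact/eqP.
split.
  apply/subspace_continuousP => t; rewrite /= in_itv/= => /andP[t0 tS].
  have c1 : q t @ within `[0, S] (nbhs t) --> h' t.
    apply: cvg_trans (qcvg t (TS t t0 tS)); apply: cvg_app.
    move=> N HN; have {}HN : \forall s \near t, time_interval T s -> N s := HN.
    change (\forall s \near t, `[0, S]%classic s -> N s).
    apply: filterS HN => s Hs /=; rewrite in_itv/= => /andP[h1 h2].
    by apply: Hs; exact: TS.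
  have c2 : (fun s => s - t) @ within `[0, S] (nbhs t) --> 0.
    apply: cvg_within_filter.
    have : (fun s : R => s - t) @ t --> t - t.
      by apply: cvgB; [exact: cvg_id|exact: cvg_cst].
    by rewrite subrr.
  rewrite (_ : h = fun s => h t + q t s * (s - t)); last first.
    by apply/funext => s; rewrite -qE addrC subrK.
  have : (fun s => h t + q t s * (s - t)) @ within `[0, S] (nbhs t) --> h t + h' t * 0.
    by apply: cvgD; [exact: cvg_cst|exact: cvgM c1 c2].
  by rewrite mulr0 addr0 /from_subspace /= subrr mulr0 addr0.
move=> t; rewrite in_itv/= => /andP[t0 tS].
have Tt := TS t (ltW t0) (ltW tS).
apply/is_derive1_caratheodory; exists (q t); split => //; last by rewrite /q eqxx.
have qt : q t t = h' t by rewrite /q eqxx.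
suff : q t @ t --> q t t by [].
rewrite qt => N /(qcvg t Tt) H.
have {}H : \forall s \near t, time_interval T s -> N (q t s) := H.
have nT : nbhs t (time_interval T).
  have : nbhs t `]0, S[%classic by apply: near_in_itvoo; rewrite in_itv/= t0.
  by apply: filterS => s /=; rewrite in_itv/= => /andP[h1 h2]; apply: TS; exact: ltW.
by apply: filterS2 nT H => s Ts; apply.
Qed.

End one_sided.

Section exponential_growth.
Context {R : realType}.

Lemma differentiable_on_expM (a b k : R) (f f1 : R -> R) :
  differentiable_on a b f f1 ->
  differentiable_on a b (fun t => expR (k * t) * f t)
    (fun t => expR (k * t) * (k * f t + f1 t)).
Proof.
have dexp x : is_derive x (1 : R) (fun t => expR (k * t)) (expR (k * x) * k).
  have dk : is_derive x (1 : R) (fun t => k * t) k.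
    by have := is_deriveZ k (is_derive_id x (1 : R)); move=> /is_derive_eq; apply; exact: mulr1.
  exact: (@is_derive1_comp _ expR (fun t => k * t) _ _ _ (is_derive_expR _) dk).
move=> [cf df]; split.
  move=> x; apply: (@continuousM _ (subspace `[a, b]) (fun t => expR (k * t)) f x); last exact: cf.
  apply: continuous_subspaceT => y.
  apply/differentiable_continuous/derivable1_diffP; exact: (@ex_derive _ _ _ _ _ _ _ (dexp y)).
move=> x /df dfx; have := is_deriveM (dexp x) dfx.
by move=> /is_derive_eq; apply; rewrite /GRing.scale /=; ring.
Qed.

Lemma differentiable_onB_scale (a b k : R) (f f1 h h1 : R -> R) :
  differentiable_on a b f f1 -> differentiable_on a b h h1 ->
  differentiable_on a b (fun t => f t - k * h t) (fun t => f1 t - k * h1 t).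
Proof.
move=> [cf df] [ch dh]; split.
  move=> x; apply: (@continuousB _ _ (subspace `[a, b]) f (fun t => k * h t) x); first exact: cf.
  by apply: (@continuousM _ (subspace `[a, b]) (fun=> k) h x); [exact: cst_continuous|exact: ch].
move=> x xab; have := is_deriveB (df x xab) (is_deriveZ k (dh x xab)).
by move=> /is_derive_eq; apply.
Qed.

(** Factor the operator: H = G' - k G satisfies H' >= - k H, so exp(k t) H is
nondecreasing and H stays nonnegative; then exp(- k t) G is nondecreasing. *)
Lemma exponential_lower_bound (S k : R) (G G1 G2 : R -> R) :
  0 <= k * G 0 <= G1 0 -> differentiable_on 0 S G G1 -> differentiable_on 0 S G1 G2 ->
  (forall t, t \in `]0, S[ -> k ^+ 2 * G t <= G2 t) ->
  forall t, 0 <= t -> t <= S -> expR (k * t) * G 0 <= G t.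
Proof.
move=> /andP[_ G10] dG dG1 HG t t0 tS.
have dH := differentiable_onB_scale k dG1 dG.
have H0 s : 0 <= s -> s <= S -> 0 <= G1 s - k * G s.
  move=> s0 sS; rewrite -(pmulr_rge0 _ (expR_gt0 (k * s))).
  apply: (@le_trans _ _ (expR (k * 0) * (G1 0 - k * G 0))).
    by rewrite mulr_ge0 ?expR_ge0// subr_ge0.
  apply: (ge0_increasing (differentiable_on_expM k dH)) => // x xS.
  rewrite mulr_ge0 ?expR_ge0//.
  have -> : k * (G1 x - k * G x) + (G2 x - k * G1 x) = G2 x - k ^+ 2 * G x by ring.
  by rewrite subr_ge0; exact: HG.
have := ge0_increasing (differentiable_on_expM (- k) dG) _ (lexx 0) t0 tS.
rewrite mulr0 expR0 mul1r => H.
have {H} : G 0 <= expR (- k * t) * G t.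
  apply: H => x; rewrite in_itv/= => /andP[x0 xS]; rewrite mulr_ge0 ?expR_ge0//.
  by rewrite mulNr addrC; apply: H0; exact: ltW.
rewrite -(ler_pM2l (expR_gt0 (k * t))) => /le_trans; apply.
by rewrite mulrA -expRD mulNr subrr expR0 mul1r.
Qed.

End exponential_growth.

(** * A weighted Hoelder inequality *)

Section weighted_hoelder.
Context d (T : measurableType d) (R : realType) (mu : {measure set T -> \bar R}).

(** Hoelder's inequality for |w| rho^(1/m) and psi rho^(1/m') with m' = m / (m - 1),
raised to the power m, where m / m' = m - 1. *)
Lemma weighted_hoelder (w psi rho : T -> R) (D : set T) (m B : R)
    (A := (\int[mu]_(x in D) (`|w x| `^ m * rho x)%:E)%E) :
  1 < m -> 0 <= B -> measurable D ->
  measurable_fun setT w -> measurable_fun setT psi -> measurable_fun setT rho ->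
  (forall x, 0 <= psi x) -> (forall x, 0 <= rho x) ->
  (A < +oo)%E ->
  (\int[mu]_(x in D) (psi x `^ (m / (m - 1)) * rho x)%:E <= B%:E)%E ->
  mu.-integrable D (EFin \o (fun x => w x * psi x * rho x)) /\
  `|\int[mu]_(x in D) (w x * psi x * rho x)| `^ m <= fine A * B `^ (m - 1).
Proof.
move=> m1 B0 mD mw mpsi mrho psi0 rho0 Afin HB.
have m0 : 0 < m by rewrite (lt_trans ltr01).
have m10 : 0 < m - 1 by rewrite subr_gt0.
pose m' := m / (m - 1); have m'0 : 0 < m' by rewrite divr_gt0.
have conj : m^-1 + m'^-1 = 1 by rewrite /m'; field; rewrite !gt_eqF.
have mind : measurable_fun setT (\1_D : T -> R) by exact: measurable_indic.
have mpow (k : R) (f : T -> R) : measurable_fun setT f -> measurable_fun setT (fun x => f x `^ k).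
  by move=> mf; exact: (measurableT_comp (measurable_powR k)).
pose f x := `|w x| * rho x `^ m^-1 * \1_D x : R.
pose h x := psi x * rho x `^ m'^-1 * \1_D x : R.
have mf : measurable_fun setT f.
  apply: measurable_funM => //; apply: measurable_funM; last exact: mpow.
  exact: measurableT_comp.
have mh : measurable_fun setT h.
  by apply: measurable_funM => //; apply: measurable_funM => //; exact: mpow.
have ind0 x : 0 <= \1_D x :> R by [].
have f0 x : 0 <= f x by rewrite /f !mulr_ge0 ?powR_ge0.
have h0 x : 0 <= h x by rewrite /h !mulr_ge0 ?powR_ge0.
have patch (u : T -> R) : (\int[mu]_(x in D) (u x)%:E = \int[mu]_x (u x * \1_D x)%:E)%E.
  rewrite integral_mkcond; apply: eq_integral => x _; rewrite patchE indicE.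
  by case: ifPn => _; rewrite ?mulr1 ?mulr0.
have indpow (k : R) x : 0 < k -> (\1_D x : R) `^ k = \1_D x.
  by move=> k0; rewrite indicE; case: (x \in D); rewrite ?powR1 ?powR0// gt_eqF.
have EA : (\int[mu]_x (`|f x| `^ m)%:E)%E = A.
  rewrite /A patch; apply: eq_integral => x _; congr EFin.
  rewrite ger0_norm// /f !powRM ?mulr_ge0 ?powR_ge0// indpow// -powRrM mulVf ?gt_eqF//.
  by rewrite powRr1.
have EB : (\int[mu]_x (`|h x| `^ m')%:E <= B%:E)%E.
  apply: le_trans HB; rewrite patch le_eqVlt; apply/orP; left; apply/eqP.
  apply: eq_integral => x _; congr EFin.
  rewrite ger0_norm// /h !powRM ?mulr_ge0 ?powR_ge0// indpow// -powRrM mulVf ?gt_eqF//.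
  by rewrite powRr1.
have EI x : (f \* h) x = `|w x * psi x * rho x| * \1_D x.
  rewrite /= /f /h !normrM (ger0_norm (psi0 x)) (ger0_norm (rho0 x)).
  have er : rho x = rho x `^ m^-1 * rho x `^ m'^-1.
    rewrite -powRD; last by rewrite conj oner_eq0.
    by rewrite conj powRr1.
  have ei : \1_D x = \1_D x * \1_D x :> R.
    by rewrite indicE; case: (x \in D); rewrite ?mulr1 ?mulr0.
  by rewrite [in RHS]er [in RHS]ei; ring.
have := hoelder mu mf mh m0 m'0 conj.
have A0 : (0 <= A)%E.
  by apply: integral_ge0 => x _; rewrite lee_fin mulr_ge0 ?powR_ge0.
have [a a0 ea] : exists2 a : R, 0 <= a & A = a%:E.
  by exists (fine A); rewrite ?fine_ge0// fineK// ge0_fin_numE.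
rewrite Lnorm1 unlock.
have -> : (\int[mu]_x `|(EFin \o (f \* h)%R) x| =
    \int[mu]_(x in D) (`|w x * psi x * rho x|)%:E)%E.
  rewrite patch; apply: eq_integral => x _.
  rewrite -EI; congr EFin; apply: ger0_norm; exact: mulr_ge0.
have -> : (\int[mu]_x `|(EFin \o f) x| `^ m)%E = A.
  by rewrite -EA; apply: eq_integral => x _; rewrite abse_EFin poweR_EFin.
have -> : (\int[mu]_x `|(EFin \o h) x| `^ m' = \int[mu]_x (`|h x| `^ m')%:E)%E.
  by apply: eq_integral => x _; rewrite abse_EFin poweR_EFin.
rewrite ea.
set Ih := (\int[mu]_x (`|h x| `^ m')%:E)%E.
have Ih0 : (0 <= Ih)%E by apply: integral_ge0 => x _; rewrite lee_fin powR_ge0.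
have [b b0 eb] : exists2 b : R, 0 <= b & Ih = b%:E.
  exists (fine Ih); rewrite ?fine_ge0// fineK// ge0_fin_numE//.
  by apply: le_lt_trans EB _; rewrite ltry.
rewrite eb !poweR_EFin -EFinM.
have bB : b <= B by rewrite -lee_fin -eb.
move=> HI.
have mF : measurable_fun setT (fun x => w x * psi x * rho x).
  by apply: measurable_funM => //; exact: measurable_funM.
have int : mu.-integrable D (EFin \o (fun x => w x * psi x * rho x)).
  apply/integrableP; split; first by apply/measurable_EFinP; exact: measurable_funTS.
  by apply: le_lt_trans HI _; rewrite ltry.
split => //.
have J0 : 0 <= \int[mu]_(x in D) `|w x * psi x * rho x| by apply: Rintegral_ge0.
have J : \int[mu]_(x in D) `|w x * psi x * rho x| <= a `^ m^-1 * b `^ m'^-1.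
  rewrite -lee_fin /Rintegral fineK//.
  rewrite ge0_fin_numE; last by apply: integral_ge0 => x _; rewrite lee_fin.
  by apply: le_lt_trans HI _; rewrite ltry.
rewrite /=; have Jn := le_trans (le_normr_Rintegral mD int) J.
apply: (@le_trans _ _ ((a `^ m^-1 * b `^ m'^-1) `^ m)).
  by rewrite ge0_ler_powR ?nnegrE ?mulr_ge0 ?powR_ge0// ltW.
rewrite powRM ?powR_ge0// -!powRrM mulVf ?gt_eqF// powRr1// ler_wpM2l//.
rewrite (_ : m'^-1 * m = m - 1); last by rewrite /m'; field; rewrite !gt_eqF.
by rewrite ge0_ler_powR ?nnegrE// ltW.
Qed.

End weighted_hoelder.

(** * Localisation to the forward domain *)

Section localisation.
Context {R : realType} {n : nat}.
Variables (g : 'rV[R]_n -> 'M[R]_n) (K : R -> R).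
Let mu := @lebesgue_rV R n.

Definition cutoff_mul (r : R) (f : 'rV[R]_n -> R) : 'rV[R]_n -> R := fun x => cutoff r x * f x.

(** A point outside the forward domain has a space-time neighbourhood in which w
vanishes almost everywhere at each time; its slices at time t cover the
complement. *)
Lemma ae_vanish_outside (T : \bar R) (w : R -> 'rV[R]_n -> R) (a R1 t : R) :
  ess_support T w `<=` forward_domain K a R1 -> time_interval T t ->
  {ae mu, forall x, ~ (radial_int K (enorm x) <= a * t + R1) -> w t x = 0}.
Proof.
move=> sw Tt; apply: (@ae_locally _ _ mu [set x | ~ (radial_int K (enorm x) <= a * t + R1)]).
move=> x /= xD.
have : ~ ess_support T w (t, x) by move=> /sw.
rewrite /ess_support/= => /not_andP[//|/contrapT[A tA AP]].
exists [set y | A (t, y)]; last exact: AP.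
case: tA => -[B1 B2] /= [nB1 nB2] B12.
by apply: filterS nB2 => y B2y; apply: B12; split => //=; exact: nbhs_singleton nB1.
Qed.

Lemma near_cutoff_mul (r : R) f x : enorm x < r -> \near x, cutoff_mul r f x = f x.
Proof.
by move=> xr; apply: filterS (nbhs_enorm_lt xr) => y /= yr; rewrite /cutoff_mul cutoff1 ?mul1r// ltW.
Qed.

Lemma laplace_beltrami_cutoff_mul (r : R) f x : enorm x < r ->
  laplace_beltrami g (cutoff_mul r f) x = laplace_beltrami g f x.
Proof.
move=> xr; apply: (congr1 ( *%R _)); apply: eq_bigr => j _.
apply: near_eq_derive.
apply: filterS (nbhs_enorm_lt xr) => y /= yr; apply: (congr1 ( *%R _)); apply: eq_bigr => k _.
apply: (congr1 ( *%R _)).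
by apply: near_eq_derive; exact: near_cutoff_mul.
Qed.

Lemma laplace_beltrami_cst (a : R) (x : 'rV[R]_n) : laplace_beltrami g (fun=> a) x = 0.
Proof.
rewrite /laplace_beltrami big1 ?mulr0// => j _.
rewrite (_ : (fun y => _) = fun=> 0); first exact: derive_cst.
apply/funext => y; rewrite big1 ?mulr0// => k _.
by rewrite [partial k _ _]derive_cst mulr0.
Qed.

Lemma pairing_local (w : 'rV[R]_n -> R) (D : set 'rV[R]_n) f h :
  {ae mu, forall x, ~ D x -> w x = 0} -> (forall x, D x -> f x = h x) ->
  pairing g w f = pairing g w h.
Proof.
move=> wD fh; apply: ae_eq_Rintegral; apply: filterS wD => x wx.
by have [/fh->//|/wx->] := pselect (D x); rewrite !mul0r.
Qed.

Lemma pairing_restrict (w : 'rV[R]_n -> R) (D : set 'rV[R]_n) f :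
  {ae mu, forall x, ~ D x -> w x = 0} ->
  pairing g w f = \int[mu]_(x in D) (w x * f x * vol_density g x).
Proof.
move=> wD; rewrite Rintegral_mkcond; apply: ae_eq_Rintegral; apply: filterS wD => x wx.
rewrite patchE; case: ifPn => // /negP xD; rewrite wx ?mul0r//.
by move=> /mem_set.
Qed.

Lemma compact_enorm_ball (r : R) : compact [set x : 'rV[R]_n | enorm x <= r].
Proof.
apply: bounded_closed_compact.
  exists (Num.max r 0); split; first exact: num_real.
  move=> M; rewrite gt_max => /andP[rM M0] x /= xr; rewrite [`|x|]mx_normrE.
  apply/bigmax_leP; split; first exact: ltW.
  move=> [i j] _ /=; rewrite (ord1 i).
  by apply: le_trans (coord_le_enorm x j) _; apply: le_trans xr (ltW rM).
apply: (@closed_comp _ _ (@enorm R n) [set y | y <= r]); last exact: closed_le.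
by move=> *; exact: continuous_enorm.
Qed.

Lemma integrable_compact_support (h : 'rV[R]_n -> R) (r : R) :
  continuous h -> (forall x, r < enorm x -> h x = 0) ->
  mu.-integrable setT (EFin \o h).
Proof.
move=> ch h0.
pose r' := Num.max r 1; have r'0 : 0 < r' by rewrite lt_max ltr01 orbT.
pose B := [set x : 'rV[R]_n | enorm x <= r'].
have mB : measurable B by exact: measurable_enorm_ball.
have fB : (lebesgue_rV n B < +oo)%E by rewrite lebesgue_rV_ball// ltry.
have cB : compact B by exact: compact_enorm_ball.
have iB : mu.-integrable B (EFin \o h).
  apply: measurable_bounded_integrable => //.
  - by apply: measurable_funTS; exact: continuous_measurable_rV.
  - have := compact_bounded (continuous_compact (continuous_subspaceT ch) cB).
    move=> [M [Mr HM]]; exists M; split => // y yM x Bx.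
    by apply: (HM y yM); exists x.
rewrite (_ : EFin \o h = (EFin \o h) \_ B); first by have [H _] := integrable_mkcond (mu := mu) (EFin \o h) mB; exact: H.
apply/funext => x; rewrite patchE; case: ifPn => //= /negP xB.
rewrite h0//; rewrite ltNge; apply/negP => xr; apply: xB.
by rewrite inE /B /= le_max xr.
Qed.

End localisation.

(** * Averages of one component *)

(** 1 + (a t + b) and 1 + t are comparable, so their powers of either sign are. *)
Lemma powR_affine (R : realType) (a b e : R) : 0 < a -> 0 <= b ->
  exists2 C, 0 < C & forall t, 0 <= t -> (1 + (a * t + b)) `^ e <= C * (1 + t) `^ e.
Proof.
move=> a0 b0; pose lo := Num.min 1 a; pose hi := 1 + a + b.
have lo0 : 0 < lo by rewrite lt_min ltr01.
have hi0 : 0 < hi by rewrite /hi; lra.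
exists (expR (`|e| * (`|ln lo| + `|ln hi|))); first exact: expR_gt0.
move=> t t0; have t1 : 0 < 1 + t by lra.
have at0 : 0 <= a * t by rewrite mulr_ge0// ltW.
have lt : lo * (1 + t) <= 1 + (a * t + b).
  rewrite mulrDr mulr1; have : lo <= 1 by rewrite ge_min lexx.
  have : lo * t <= a * t by rewrite ler_wpM2r// ge_min lexx orbT.
  lra.
have ht : 1 + (a * t + b) <= hi * (1 + t).
  have : 0 <= b * t by rewrite mulr_ge0.
  rewrite /hi; lra.
have s0 : 0 < 1 + (a * t + b) by lra.
rewrite /powR !gt_eqF// -expRD ler_expR.
have l1 : ln lo + ln (1 + t) <= ln (1 + (a * t + b)).
  by rewrite -lnM ?posrE// ler_ln ?posrE// mulr_gt0.
have l2 : ln (1 + (a * t + b)) <= ln hi + ln (1 + t).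
  by rewrite -lnM ?posrE// ler_ln ?posrE// mulr_gt0.
rewrite -lerBlDr -mulrBr; apply: le_trans (ler_norm _) _; rewrite normrM ler_wpM2l//.
rewrite ler_norml; have := ler_norm (ln hi); have := ler_norm (- ln lo).
have := normr_ge0 (ln hi); have := normr_ge0 (ln lo); rewrite normrN.
move: `|ln hi| `|ln lo| => x y ? ? ? ?; apply/andP; split; lra.
Qed.

Section component.
Context {R : realType} {n : nat}.
Hypothesis n0 : (0 < n)%N.
Variables (g : 'rV[R]_n -> 'M[R]_n) (K : R -> R) (delta : R).
Hypothesis delta0 : 0 < delta.
Hypothesis cK : {within `[0, +oo[, continuous K}.
Hypothesis KB : forall r, 0 <= r -> delta < K r /\ K r < delta^-1.
Hypothesis gsym : forall x, (g x)^T = g x.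
Hypothesis gE : forall x xi, delta * enorm xi ^+ 2 <= quad (invmx (g x)) xi.
Hypothesis gC : forall j k, continuous (fun x => g x j k).

Let mu := @lebesgue_rV R n.
Let D s : set 'rV[R]_n := [set x | radial_int K (enorm x) <= s].

Let mD s : measurable (D s).
Proof. by apply: measurable_sublevel; exact: (measurable_radial_int delta0 cK KB). Qed.

Let D_enorm s x : D s x -> enorm x <= delta^-1 * s.
Proof.
move=> Dx; rewrite ler_pdivlMl//.
exact: le_trans (radial_int_ge cK KB (enorm_ge0 x)) Dx.
Qed.

Let mdens : measurable_fun setT (vol_density g).
Proof. exact: (measurable_vol_density gC). Qed.

Lemma volume_weight : exists2 C, 0 < C & forall s, 0 <= s ->
  (\int[mu]_(x in D s) (vol_density g x)%:E <= (C * (1 + s) `^ n%:R)%:E)%E.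
Proof.
have [Dm Dm0 HDm] := vol_density_bounded delta0 gsym gE.
have V0 := unit_ball_volume_ge0 (R := R) n.
exists (Dm * (delta^-1 ^+ n * unit_ball_volume n) + 1).
  by rewrite ltr_pwDr// mulr_ge0 ?(ltW Dm0)// mulr_ge0// exprn_ge0// invr_ge0 ltW.
move=> s s0; have s1 : 0 < 1 + s by lra.
have r0 : 0 < delta^-1 * (1 + s) by rewrite mulr_gt0// invr_gt0.
apply: (@le_trans _ _ (\int[mu]_(x in D s) (Dm%:E))%E).
  apply: ge0_le_integral => //.
  - by move=> x _; rewrite lee_fin vol_density_ge0.
  - by apply/measurable_EFinP; exact: measurable_funTS.
  - by move=> x _; rewrite lee_fin.
rewrite integral_cst//.
have h : (mu (D s) <= ((delta^-1 * (1 + s)) ^+ n * unit_ball_volume n)%:E)%E.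
  rewrite -lebesgue_rV_ball//; apply: le_measure; rewrite ?inE//.
    exact: measurable_enorm_ball.
  move=> x /D_enorm /= h; apply: le_trans h _.
  by rewrite ler_wpM2l ?invr_ge0 ?(ltW delta0)//; lra.
apply: le_trans (lee_wpmul2l _ h) _; first by rewrite lee_fin ltW.
rewrite -EFinM lee_fin powR_mulrn ?(ltW s1)// exprMn.
rewrite [leLHS](_ : _ = (Dm * (delta^-1 ^+ n * unit_ball_volume n)) * (1 + s) ^+ n); last by ring.
by rewrite ler_wpM2r ?lerDl// exprn_ge0// ltW.
Qed.

(** The decaying factor of the bound on phi, raised to the power m', is of order
(1 + r)^(- (n - 1) m' / 2). *)
Lemma eigenfunction_weight (c0 lambda m' : R) (phi : 'rV[R]_n -> R) :
  0 < c0 -> 0 < lambda -> 0 < m' -> growing_eigenfunction g K c0 lambda phi ->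
  exists2 C, 0 < C & forall s, 0 <= s ->
  (\int[mu]_(x in D s) (phi x `^ m' * vol_density g x)%:E <=
   (C * (1 + s) `^ (n%:R - 1 - (n%:R - 1) / 2 * m') * expR (m' * lambda * s))%:E)%E.
Proof.
move=> c00 l0 m0 [sphi _ Hphi].
have [Dm Dm0 HDm] := vol_density_bounded delta0 gsym gE.
have n1 : 0 <= (n%:R - 1) / 2 :> R by rewrite divr_ge0// subr_ge0 ler1n.
have C0 : 0 <= (c0^-1 `^ m' * Dm) by rewrite mulr_ge0 ?powR_ge0// ltW.
have cphi : continuous phi by exact: Ck_continuous (sphi 0%N).
have [C C_0 HC] := weighted_sublevel_bound n0 delta0 (@radial_int0 _ K)
  (radial_int_lipschitz cK KB) (measurable_radial_int delta0 cK KB (n:=n)) l0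
  (mulr_ge0 n1 (ltW m0)) (mulr_gt0 m0 l0) C0.
exists C => // s s0; apply: HC => // [|x|x].
- apply: measurable_funM => //.
  by apply: (measurableT_comp (measurable_powR m')); exact: continuous_measurable_rV.
- by rewrite mulr_ge0 ?powR_ge0// vol_density_ge0.
have [h1 h2] := Hphi x.
have px : 0 <= phi x by rewrite ltW// (lt_trans c00).
have j0 : 0 < japanese (lambda * enorm x).
  by rewrite sqrtr_gt0 ltr_pwDl// sqr_ge0.
rewrite [leRHS](_ : _ = (c0^-1 `^ m' * japanese (lambda * enorm x) `^ (- ((n%:R - 1) / 2 * m')) *
   expR (m' * lambda * radial_int K (enorm x))) * Dm); last by ring.
apply: ler_pM; rewrite ?powR_ge0 ?vol_density_ge0//.
apply: (@le_trans _ _ ((c0^-1 * japanese (lambda * enorm x) `^ (- ((n%:R - 1) / 2)) * expR (lambda * radial_int K (enorm x))) `^ m')).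
  rewrite ge0_ler_powR ?nnegrE//; last exact: ltW.
    exact: ltW.
  by rewrite !mulr_ge0 ?powR_ge0 ?expR_ge0// invr_ge0 ltW.
rewrite !powRM ?mulr_ge0 ?powR_ge0 ?expR_ge0 ?invr_ge0 ?(ltW c00)//.
by rewrite -powRrM powR_expR mulNr mulrA.
Qed.

Lemma mass_finite (f : 'rV[R]_n -> R) s : Defs.locally_integrable f -> (forall x, 0 <= f x) ->
  (\int[mu]_(x in D s) (f x * vol_density g x)%:E < +oo)%E.
Proof.
move=> [mf lf] f0.
have [Dm Dm0 HDm] := vol_density_bounded delta0 gsym gE.
pose r := Num.max (delta^-1 * s) 1; have r0 : 0 < r by rewrite lt_max ltr01 orbT.
pose B := [set x : 'rV[R]_n | enorm x <= r].
have mB : measurable B by exact: measurable_enorm_ball.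
have cB : compact B by exact: compact_enorm_ball.
have /integrableP[_ fB] := lf B cB.
apply: (@le_lt_trans _ _ (\int[mu]_(x in B) (Dm%:E * (f x)%:E))%E); last first.
  rewrite ge0_integralZl//; last 3 first.
  - by apply/measurable_EFinP; exact: measurable_funTS.
  - by move=> x _; rewrite lee_fin.
  - by rewrite lee_fin ltW.
  apply: lte_mul_pinfty; rewrite ?lee_fin ?(ltW Dm0)//.
  rewrite (eq_integral (fun x => `|(EFin \o f) x|%E))// => x _.
  by rewrite /= ger0_norm.
apply: (@le_trans _ _ (\int[mu]_(x in B) (f x * vol_density g x)%:E)%E).
  apply: ge0_subset_integral => //.
  - by apply/measurable_EFinP; apply: measurable_funTS; exact: measurable_funM.
  - by move=> x _; rewrite lee_fin mulr_ge0// vol_density_ge0.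
  - by move=> x /D_enorm h; rewrite /B/= le_max h.
apply: ge0_le_integral => //.
- by move=> x _; rewrite lee_fin mulr_ge0// vol_density_ge0.
- by apply/measurable_EFinP; apply: measurable_funTS; exact: measurable_funM.
- by apply/measurable_EFinP; apply: measurable_funTS; exact: measurable_funM.
- by move=> x _; rewrite -EFinM lee_fin mulrC ler_wpM2r.
Qed.


Lemma pairing_mass (w : 'rV[R]_n -> R) (m s r : R) : 0 < m ->
  {ae mu, forall x, ~ D s x -> w x = 0} -> (forall x, D s x -> enorm x < r) ->
  pairing g (fun x => `|w x| `^ m) (cutoff_mul r (fun=> 1)) =
    fine (\int[mu]_(x in D s) (`|w x| `^ m * vol_density g x)%:E)%E.
Proof.
move=> m0 wD Dr.
have wD' : {ae mu, forall x, ~ D s x -> `|w x| `^ m = 0}.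
  by apply: filterS wD => x wx /wx ->; rewrite normr0 powR0// gt_eqF.
rewrite (pairing_restrict g _ wD'); congr fine; apply: eq_integral => x.
by rewrite inE => /Dr xr; rewrite /cutoff_mul cutoff1 ?mulr1// ltW.
Qed.

(** The solution lives where the cutoff is 1, so that the cutoff disappears from both
pairings. *)
Lemma pairing_hoelder (w psi : 'rV[R]_n -> R) (m s r B : R) : 1 < m -> 0 <= B ->
  measurable_fun setT w -> Defs.locally_integrable (fun x => `|w x| `^ m) ->
  {ae mu, forall x, ~ D s x -> w x = 0} -> (forall x, D s x -> enorm x < r) ->
  measurable_fun setT psi -> (forall x, 0 <= psi x) ->
  (\int[mu]_(x in D s) (psi x `^ (m / (m - 1)) * vol_density g x)%:E <= B%:E)%E ->
  mu.-integrable (D s) (EFin \o (fun x => w x * psi x * vol_density g x)) /\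
  `|pairing g w (cutoff_mul r psi)| `^ m <=
    pairing g (fun x => `|w x| `^ m) (cutoff_mul r (fun=> 1)) * B `^ (m - 1).
Proof.
move=> m1 B0 mw lw wD Dr mpsi psi0 HB.
have m0 : 0 < m by rewrite (lt_trans ltr01).
have e : pairing g w (cutoff_mul r psi) = \int[mu]_(x in D s) (w x * psi x * vol_density g x).
  rewrite -(pairing_restrict g psi wD); apply: (pairing_local g wD) => x /Dr xr.
  by rewrite /cutoff_mul cutoff1 ?mul1r// ltW.
rewrite e (pairing_mass m0 wD Dr).
apply: weighted_hoelder => //; first by move=> x; exact: vol_density_ge0.
by apply: mass_finite => // x; exact: powR_ge0.
Qed.

(** [pairing_hoelder] for psi = 1 and psi = phi, with s = a t + R1. The integral of
the weight enters with the power m - 1, which turns the exponents n and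
(n - 1) (1 - m' / 2), m' = m / (m - 1), into n (m - 1) and (n - 1) (m / 2 - 1). *)
Lemma mass_lower_bounds (m a R1 c0 lambda : R) (phi : 'rV[R]_n -> R) :
  1 < m -> 0 < a -> 0 <= R1 -> 0 < c0 -> 0 < lambda ->
  growing_eigenfunction g K c0 lambda phi ->
  exists2 C, 0 < C & forall (t r : R) (w : 'rV[R]_n -> R)
      (M := pairing g (fun x => `|w x| `^ m) (cutoff_mul r (fun=> 1))),
    0 <= t -> measurable_fun setT w ->
    Defs.locally_integrable (fun x => `|w x| `^ m) ->
    {ae mu, forall x, ~ (radial_int K (enorm x) <= a * t + R1) -> w x = 0} ->
    (forall x, D (a * t + R1) x -> enorm x < r) ->
    `|pairing g w (cutoff_mul r (fun=> 1))| `^ m <= C * (1 + t) `^ (n%:R * (m - 1)) * M /\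
    `|pairing g w (cutoff_mul r phi)| `^ m <=
      C * (1 + t) `^ ((n%:R - 1) * (m / 2 - 1)) * expR (m * lambda * a * t) * M.
Proof.
move=> m1 a0 R10 c00 l0 Hphi.
have m10 : 0 < m - 1 by rewrite subr_gt0.
have m0 : 0 < m by rewrite (lt_trans ltr01).
pose m' := m / (m - 1); have m'0 : 0 < m' by rewrite divr_gt0.
have [C1 C10 HC1] := volume_weight.
have [C2 C20 HC2] := eigenfunction_weight c00 l0 m'0 Hphi.
pose e1 := n%:R * (m - 1); pose e2 := (n%:R - 1) * (m / 2 - 1).
have [C3 C30 HC3] := powR_affine e1 a0 R10.
have [C4 C40 HC4] := powR_affine e2 a0 R10.
pose Ca := C1 `^ (m - 1) * C3.
pose Cb := C2 `^ (m - 1) * C4 * expR (m * lambda * R1).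
have Ca0 : 0 < Ca by rewrite mulr_gt0// powR_gt0.
have Cb0 : 0 < Cb by rewrite !mulr_gt0// ?powR_gt0// expR_gt0.
exists (Num.max Ca Cb); first by rewrite lt_max Ca0.
move=> t r w M t0 mw lw wD Dr.
have M0 : 0 <= M.
  apply: Rintegral_ge0 => x _; apply: mulr_ge0; last exact: vol_density_ge0.
  by rewrite mulr_ge0 ?powR_ge0// mulr_ge0// cutoff_ge0.
pose s := a * t + R1.
have s0 : 0 <= s by rewrite addr_ge0// mulr_ge0// ltW.
have s1 : 0 < 1 + s by rewrite ltr_pwDl.
have t1 : 0 < 1 + t by rewrite ltr_pwDl.
have [sphi _ Bphi] := Hphi.
split.
- have B0 : 0 <= C1 * (1 + s) `^ n%:R by rewrite mulr_ge0 ?powR_ge0// ltW.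
  have W1 : (\int[mu]_(x in D s) ((fun=> 1) x `^ (m / (m - 1)) * vol_density g x)%:E <=
      (C1 * (1 + s) `^ n%:R)%:E)%E.
    rewrite (eq_integral (fun x => (vol_density g x)%:E)); first exact: HC1.
    by move=> x _; rewrite powR1 mul1r.
  have [_ H] := pairing_hoelder m1 B0 mw lw wD Dr (measurable_cst _) (fun=> ler01) W1.
  apply: le_trans H _; rewrite -/M mulrC ler_wpM2r//.
  rewrite powRM ?powR_ge0 ?(ltW C10)// -powRrM -/e1.
  apply: (@le_trans _ _ (C1 `^ (m - 1) * (C3 * (1 + t) `^ e1))).
    by rewrite ler_wpM2l ?powR_ge0// HC3.
  by rewrite mulrA ler_wpM2r ?powR_ge0// le_max lexx.
- have B0 : 0 <= C2 * (1 + s) `^ (n%:R - 1 - (n%:R - 1) / 2 * m') * expR (m' * lambda * s).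
    by rewrite !mulr_ge0 ?powR_ge0 ?expR_ge0// ltW.
  have cphi : continuous phi by exact: Ck_continuous (sphi 0%N).
  have phi0 x : 0 <= phi x by have [h _] := Bphi x; rewrite ltW// (lt_trans c00).
  have [_ H] := pairing_hoelder m1 B0 mw lw wD Dr (continuous_measurable_rV cphi) phi0 (HC2 s s0).
  apply: le_trans H _; rewrite -/M mulrC ler_wpM2r//.
  rewrite !powRM ?mulr_ge0 ?powR_ge0 ?expR_ge0 ?(ltW C20)// -powRrM powR_expR.
  have -> : (n%:R - 1 - (n%:R - 1) / 2 * m') * (m - 1) = e2.
    by rewrite /e2 /m'; field; rewrite gt_eqF.
  have -> : (m - 1) * (m' * lambda * s) = m * lambda * a * t + m * lambda * R1.
    by rewrite /m' /s; field; rewrite gt_eqF.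
  rewrite expRD.
  apply: (@le_trans _ _ (C2 `^ (m - 1) * (C4 * (1 + t) `^ e2) * (expR (m * lambda * a * t) * expR (m * lambda * R1)))).
    by rewrite ler_wpM2r ?mulr_ge0 ?expR_ge0// ler_wpM2l ?powR_ge0// HC4.
  rewrite [leLHS](_ : _ = Cb * (1 + t) `^ e2 * expR (m * lambda * a * t)); last by rewrite /Cb; ring.
  by rewrite ler_wpM2r ?expR_ge0// ler_wpM2r ?powR_ge0// le_max lexx orbT.
Qed.


Lemma vanish_outside_support (f : 'rV[R]_n -> R) (R0 : R) x :
  closed_support f `<=` [set x | enorm x <= R0] -> R0 < enorm x -> f x = 0.
Proof.
move=> sf xR; apply/eqP/negP => /negP fx.
have /sf /= : closed_support f x by apply: subset_closure.
by rewrite leNgt xR.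
Qed.

Lemma pairing_initial (f psi : 'rV[R]_n -> R) (eps R0 r : R) :
  continuous f -> continuous psi ->
  closed_support f `<=` [set x | enorm x <= R0] -> R0 <= r ->
  mu.-integrable setT (EFin \o (fun x => f x * psi x * vol_density g x)) /\
  pairing g (fun x => eps * f x) (cutoff_mul r psi) = eps * vol_int g (fun x => f x * psi x).
Proof.
move=> cf cpsi sf R0r.
have int : mu.-integrable setT (EFin \o (fun x => f x * psi x * vol_density g x)).
  apply: (@integrable_compact_support _ _ _ R0) => [x|x xR].
    apply: (@continuousM _ _ (fun x => f x * psi x)); last exact: continuous_vol_density.
    by apply: continuousM; [exact: cf|exact: cpsi].
  by rewrite (vanish_outside_support sf xR) !mul0r.
split => //; rewrite /pairing /vol_int -RintegralZl//.
apply: eq_Rintegral => x _; rewrite /cutoff_mul.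
have [xR|xR] := ltP R0 (enorm x).
  by rewrite (vanish_outside_support sf xR) !(mulr0, mul0r).
by rewrite cutoff1 ?mul1r ?mulrA// (le_trans xR).
Qed.

(** The cutoff times 1 has Laplacian 0 on the support of w, and the cutoff times phi
has Laplacian lambda^2 phi there. Since F >= 0, the second pairing satisfies the
hypotheses of [exponential_lower_bound] with rate a lambda; those on its initial
values are the conditions on w0 and w1. *)
Lemma wave_energy (m a c0 lambda eps S r R0 R1 : R) (T : \bar R)
    (w F : R -> 'rV[R]_n -> R) (w0 w1 phi : 'rV[R]_n -> R)
    (W := fun t => pairing g (w t) (cutoff_mul r (fun=> 1))) :
  1 < m -> 0 < a -> 0 <= R1 -> 0 < c0 -> 0 < lambda -> 0 < eps -> 0 < S -> (S%:E < T)%E ->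
  growing_eigenfunction g K c0 lambda phi ->
  wave_cauchy g a F (fun x => eps * w0 x) (fun x => eps * w1 x) T w ->
  (forall t x, 0 <= F t x) ->
  ess_support T w `<=` forward_domain K a R1 ->
  (forall t, time_interval T t -> measurable_fun setT (w t)) ->
  (forall t, time_interval T t -> Defs.locally_integrable (fun x => `|w t x| `^ m)) ->
  (forall x, D (a * S + R1) x -> enorm x < r) -> R0 <= r ->
  test_function w0 -> test_function w1 ->
  (forall x, 0 <= w0 x) -> (forall x, 0 <= w1 x) ->
  closed_support w0 `<=` [set x | enorm x <= R0] ->
  closed_support w1 `<=` [set x | enorm x <= R0] ->
  0 < vol_int g (fun x => w0 x * phi x) ->
  0 < vol_int g (fun x => (w1 x - a * lambda * w0 x) * phi x) ->
  (exists W1 W2, [/\ differentiable_on 0 S W W1, differentiable_on 0 S W1 W2,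
     0 <= W 0, 0 <= W1 0 &
     forall t, t \in `]0, S[ -> W2 t = pairing g (F t) (cutoff_mul r (fun=> 1))]) /\
  forall t, 0 <= t -> t <= S ->
    eps * vol_int g (fun x => w0 x * phi x) * expR (a * lambda * t) <=
    pairing g (w t) (cutoff_mul r phi).
Proof.
move=> m1 a0 R10 c00 l0 eps0 S0 ST Hphi Hw F0 sw mw lw DS R0r [sw0 _] [sw1 _] w00 w10 sup0 sup1 I0 I1.
have TS t : 0 <= t -> t <= S -> time_interval T t.
  by move=> t0 tS; split => //; apply: le_lt_trans ST; rewrite lee_fin.
have wD t : time_interval T t -> {ae mu, forall x, ~ D (a * t + R1) x -> w t x = 0}.
  exact: ae_vanish_outside sw.
have Dr t : t <= S -> forall x, D (a * t + R1) x -> enorm x < r.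
  move=> tS x Dx; apply: DS; apply: le_trans Dx _.
  by rewrite lerD2r ler_wpM2l// ltW.
have cutoff_mul_ge0 (f : 'rV[R]_n -> R) x : 0 <= f x -> 0 <= cutoff_mul r f x.
  by move=> fx; rewrite mulr_ge0// cutoff_ge0.
have pairing_ge0 (f psi : 'rV[R]_n -> R) : (forall x, 0 <= f x) -> (forall x, 0 <= psi x) ->
    0 <= pairing g f psi.
  by move=> f0 p0; apply: Rintegral_ge0 => x _; rewrite !mulr_ge0// vol_density_ge0.
have [sphi LB Bphi] := Hphi.
have cphi : continuous phi by exact: Ck_continuous (sphi 0%N).
have phi0 x : 0 <= phi x by have [h _] := Bphi x; rewrite ltW// (lt_trans c00).
split.
- have [W1 [W2 [[dW dW1 _] Wini W1ini Weq]]] :=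
    Hw _ (test_function_cutoffM r (fun k => Ck_cst k (1 : R))).
  exists W1, W2; split.
  + exact: derivative_within_differentiable_on dW.
  + exact: derivative_within_differentiable_on dW1.
  + rewrite /W [X in _ <= X]Wini; apply: pairing_ge0 => x; first by rewrite mulr_ge0// ltW.
    exact: cutoff_mul_ge0.
  + rewrite W1ini; apply: pairing_ge0 => x; first by rewrite mulr_ge0// ltW.
    exact: cutoff_mul_ge0.
  + move=> t; rewrite in_itv/= => /andP[t0 tS].
    have Tt := TS t (ltW t0) (ltW tS); have [_ tT] := Tt.
    rewrite -(Weq t t0 tT) (pairing_local g (wD t Tt) (h := fun=> 0)).
      rewrite [pairing g (w t) (fun=> 0)](_ : _ = 0) ?mulr0 ?subr0//.
      rewrite /pairing /vol_int (_ : (fun x => _) = cst 0) ?Rintegral_cst ?mul0r//.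
      by apply/funext => x; rewrite mulr0 mul0r.
    by move=> x /(Dr t (ltW tS)) xr; rewrite laplace_beltrami_cutoff_mul// laplace_beltrami_cst.
have [G1 [G2 [[dG dG1 _] Gini G1ini Geq]]] := Hw _ (test_function_cutoffM r sphi).
pose I0' := vol_int g (fun x => w0 x * phi x).
have [int0 E0] := pairing_initial eps (Ck_continuous (sw0 0%N)) cphi sup0 R0r.
have [int1 E1] := pairing_initial eps (Ck_continuous (sw1 0%N)) cphi sup1 R0r.
have G0 : pairing g (w 0) (cutoff_mul r phi) = eps * I0' by rewrite [LHS]Gini.
have G10 : G1 0 = eps * vol_int g (fun x => w1 x * phi x) by rewrite G1ini.
have EI : vol_int g (fun x => (w1 x - a * lambda * w0 x) * phi x) =
    vol_int g (fun x => w1 x * phi x) - a * lambda * I0'.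
  rewrite /I0' /vol_int -RintegralZl// -RintegralB//; last first.
    by have := integrableZl measurableT (a * lambda) int0; apply: eq_integrable => // x _; rewrite /= EFinM.
  by apply: eq_Rintegral => x _; ring.
move=> t t0 tS; rewrite -G0 mulrC.
apply: (@exponential_lower_bound _ S (a * lambda)
   (fun t => pairing g (w t) (cutoff_mul r phi)) G1 G2) => //.
- rewrite G0 G10; apply/andP; split.
    by rewrite mulr_ge0 ?mulr_ge0// ltW.
  by rewrite mulrCA ler_pM2l// -subr_ge0 -EI ltW.
- exact: derivative_within_differentiable_on dG.
- exact: derivative_within_differentiable_on dG1.
move=> s; rewrite in_itv/= => /andP[s0 sS].
have Ts := TS s (ltW s0) (ltW sS); have [_ sT] := Ts.
have := Geq s s0 sT.
have m10 : 0 < m - 1 by rewrite subr_gt0.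
have m'0 : 0 < m / (m - 1) by rewrite divr_gt0// (lt_trans ltr01).
have [C2 C20 HC2] := eigenfunction_weight c00 l0 m'0 Hphi.
have as0 : 0 <= a * s + R1 by rewrite addr_ge0// mulr_ge0// ltW.
have B0 : 0 <= C2 * (1 + (a * s + R1)) `^ (n%:R - 1 - (n%:R - 1) / 2 * (m / (m - 1))) *
    expR (m / (m - 1) * lambda * (a * s + R1)).
  by rewrite !mulr_ge0 ?powR_ge0 ?expR_ge0// ltW.
have [int _] := pairing_hoelder m1 B0 (mw s Ts) (lw s Ts) (wD s Ts) (Dr s (ltW sS))
  (continuous_measurable_rV cphi) phi0 (HC2 _ as0).
have -> : pairing g (w s) (laplace_beltrami g (fun x => cutoff r x * phi x)) =
    lambda ^+ 2 * pairing g (w s) (cutoff_mul r phi).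
  rewrite (pairing_local g (wD s Ts) (h := fun x => lambda ^+ 2 * phi x)); last first.
    by move=> x /(Dr s (ltW sS)) xr; rewrite laplace_beltrami_cutoff_mul// LB.
  rewrite (pairing_local g (wD s Ts) (f := cutoff_mul r phi) (h := phi)); last first.
    by move=> x /(Dr s (ltW sS)) xr; rewrite /cutoff_mul cutoff1 ?mul1r// ltW.
  rewrite !(pairing_restrict g _ (wD s Ts)) -RintegralZl//.
  by apply: eq_Rintegral => x _; ring.
have : 0 <= pairing g (F s) (fun x => cutoff r x * phi x).
  by apply: pairing_ge0 => // x; exact: cutoff_mul_ge0.
rewrite exprMn -mulrA; move: (pairing g (F s) _) (pairing g (w s) _) => x y x0 e.
by rewrite -e in x0; lra.
Qed.

End component.

(** * The coupled system and its lifespan *)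

(** The growth exp(lam t) of G and that of the weight in its Hoelder bound cancel,
which leaves a power of 1 + t. *)
Lemma source_bounds (R : realType) (C k m N lam t eps J V G M : R) :
  0 < C -> 0 <= t -> 0 < eps -> 0 < J -> 0 < m -> k <= C^-1 -> k <= J `^ m / C ->
  `|V| `^ m <= C * (1 + t) `^ (N * (m - 1)) * M ->
  `|G| `^ m <= C * (1 + t) `^ ((N - 1) * (m / 2 - 1)) * expR (m * (lam * t)) * M ->
  eps * J * expR (lam * t) <= G ->
  k * eps `^ m * (1 + t) `^ ((N - 1) * (1 - m / 2)) <= M /\
  k * (1 + t) `^ (- (N * (m - 1))) * `|V| `^ m <= M.
Proof.
move=> C0 t0 eps0 J0 m0 kC kJ HV HG Glow.
have t1 : 0 < 1 + t by lra.
have split_pow (e : R) : (1 + t) `^ (- e) * (1 + t) `^ e = 1.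
  by rewrite powRN mulVf// gt_eqF// powR_gt0.
split; last first.
- have h : (1 + t) `^ (- (N * (m - 1))) * `|V| `^ m <= C * M.
    apply: (@le_trans _ _ ((1 + t) `^ (- (N * (m - 1))) * (C * (1 + t) `^ (N * (m - 1)) * M))).
      by rewrite ler_wpM2l// powR_ge0.
    rewrite (_ : _ * (C * _ * M) = (1 + t) `^ (- (N * (m - 1))) * (1 + t) `^ (N * (m - 1)) * (C * M)); last by ring.
    by rewrite split_pow mul1r.
  rewrite -mulrA; apply: (@le_trans _ _ (C^-1 * ((1 + t) `^ (- (N * (m - 1))) * `|V| `^ m))).
    by rewrite ler_wpM2r// mulr_ge0 ?powR_ge0.
  by rewrite ler_pdivrMl.
pose e := (N - 1) * (m / 2 - 1); rewrite -/e in HG.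
have -> : (N - 1) * (1 - m / 2) = - e by rewrite /e; ring.
have G0 : 0 <= eps * J * expR (lam * t) by rewrite !mulr_ge0 ?expR_ge0// ltW.
have h : eps `^ m * J `^ m * expR (m * (lam * t)) <= C * (1 + t) `^ e * expR (m * (lam * t)) * M.
  apply: le_trans HG; rewrite -powR_expR -!powRM ?mulr_ge0 ?expR_ge0 ?(ltW eps0) ?(ltW J0)//.
  rewrite ge0_ler_powR ?nnegrE ?(ltW m0)//.
  exact: le_trans (ler_norm _).
rewrite [X in _ <= X]mulrAC ler_pM2r ?expR_gt0// in h.
have h2 : J `^ m * eps `^ m * (1 + t) `^ (- e) <= C * M.
  apply: (@le_trans _ _ (C * (1 + t) `^ e * M * (1 + t) `^ (- e))).
    by rewrite ler_wpM2r ?powR_ge0// mulrC.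
  rewrite (_ : C * (1 + t) `^ e * M * _ = (1 + t) `^ (- e) * (1 + t) `^ e * (C * M)); last by ring.
  by rewrite split_pow mul1r.
apply: (@le_trans _ _ ((J `^ m / C) * eps `^ m * (1 + t) `^ (- e))).
  by rewrite ler_wpM2r ?powR_ge0// ler_wpM2r ?powR_ge0.
rewrite (_ : _ * _ = C^-1 * (J `^ m * eps `^ m * (1 + t) `^ (- e))); last by ring.
by rewrite ler_pdivrMl.
Qed.

Section system.
Context {R : realType} {n : nat}.
Variables (p q c : R) (g : 'rV[R]_n -> 'M[R]_n) (K : R -> R).
Variables (c0 lambda : R) (phi u0 u1 v0 v1 : 'rV[R]_n -> R) (R0 R1 : R).
Hypotheses (n0 : (0 < n)%N) (p1 : 1 < p) (q1 : 1 < q) (cp : 0 < c).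
Hypothesis hg : asymptotically_euclidean g K.
Hypotheses (c00 : 0 < c0) (l0 : 0 < lambda).
Hypothesis hphi : growing_eigenfunction g K c0 lambda phi.
Hypotheses (hu0 : test_function u0) (hu1 : test_function u1).
Hypotheses (hv0 : test_function v0) (hv1 : test_function v1).
Hypotheses (hu0_ge0 : forall x, 0 <= u0 x) (hu1_ge0 : forall x, 0 <= u1 x).
Hypotheses (hv0_ge0 : forall x, 0 <= v0 x) (hv1_ge0 : forall x, 0 <= v1 x).
Hypothesis R00 : 0 < R0.
Hypothesis hu0_supp : closed_support u0 `<=` [set x | enorm x <= R0].
Hypothesis hu1_supp : closed_support u1 `<=` [set x | enorm x <= R0].
Hypothesis hv0_supp : closed_support v0 `<=` [set x | enorm x <= R0].
Hypothesis hv1_supp : closed_support v1 `<=` [set x | enorm x <= R0].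
Hypothesis hu0_phi : 0 < vol_int g (fun x => u0 x * phi x).
Hypothesis hu1_phi : 0 < vol_int g (fun x => (u1 x - c * lambda * u0 x) * phi x).
Hypothesis hv0_phi : 0 < vol_int g (fun x => v0 x * phi x).
Hypothesis hv1_phi : 0 < vol_int g (fun x => (v1 x - lambda * v0 x) * phi x).
Hypothesis hR1 : radial_int K R0 <= R1.

(** Both components are tested with the same cutoff, which depends on S; the constant
k comes from [mass_lower_bounds] and from the data only. *)
Lemma averaged_system : exists2 k, 0 < k &
  forall (eps S : R) (T : \bar R) u v, 0 < eps -> 0 < S -> (S%:E < T)%E ->
  weak_solution g K p q c R1 eps u0 u1 v0 v1 T u v ->
  exists U U1 U2 V V1 V2,
  [/\ [/\ differentiable_on 0 S U U1, differentiable_on 0 S U1 U2,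
        differentiable_on 0 S V V1 & differentiable_on 0 S V1 V2],
      [/\ 0 <= U 0, 0 <= U1 0, 0 <= V 0 & 0 <= V1 0],
      forall t, t \in `]0, S[ ->
        k * eps `^ p * (1 + t) `^ ((n%:R - 1) * (1 - p / 2)) <= U2 t /\
        k * (1 + t) `^ (- (n%:R * (p - 1))) * `|V t| `^ p <= U2 t &
      forall t, t \in `]0, S[ ->
        k * eps `^ q * (1 + t) `^ ((n%:R - 1) * (1 - q / 2)) <= V2 t /\
        k * (1 + t) `^ (- (n%:R * (q - 1))) * `|U t| `^ q <= V2 t].
Proof.
have [[sg gsym _] cK _ _ _ _ _ [delta [d0 _ ell KB]]] := hg.
have gE x xi := (ell x xi).1.
have gC j k : continuous (fun x => g x j k) by exact: Ck_continuous (sg j k 0%N).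
have R10 : 0 <= R1.
  apply: le_trans hR1; apply: le_trans (radial_int_ge cK KB (ltW R00)).
  by rewrite mulr_ge0// ltW.
have p0 : 0 < p by rewrite (lt_trans ltr01).
have q0 : 0 < q by rewrite (lt_trans ltr01).
have [Cv Cv0 HCv] := mass_lower_bounds n0 d0 cK KB gsym gE gC p1 ltr01 R10 c00 l0 hphi.
have [Cu Cu0 HCu] := mass_lower_bounds n0 d0 cK KB gsym gE gC q1 cp R10 c00 l0 hphi.
pose Ju := vol_int g (fun x => u0 x * phi x).
pose Jv := vol_int g (fun x => v0 x * phi x).
pose k := Num.min (Num.min Cv^-1 (Jv `^ p / Cv)) (Num.min Cu^-1 (Ju `^ q / Cu)).
exists k.
  by rewrite !lt_min !invr_gt0 !divr_gt0 ?powR_gt0// Cv0 Cu0.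
have kv1 : k <= Cv^-1 by rewrite /k !ge_min lexx.
have kv2 : k <= Jv `^ p / Cv by rewrite /k !ge_min lexx orbT.
have ku1 : k <= Cu^-1 by rewrite /k !ge_min lexx !orbT.
have ku2 : k <= Ju `^ q / Cu by rewrite /k !ge_min lexx !orbT.
move=> eps S T u v eps0 S0 ST [T0 meas loc _ equ eqv su sv].
(* Beyond both forward domains up to time S, as c + 1 bounds both speeds, and
beyond the support of the data. *)
pose r := delta^-1 * ((c + 1) * S + R1) + 1 + R0.
have di0 : 0 < delta^-1 by rewrite invr_gt0.
have cS0 : 0 < (c + 1) * S by rewrite mulr_gt0// addr_gt0.
have R0r : R0 <= r.
  by rewrite /r lerDr addr_ge0// mulr_ge0 ?(ltW di0)// addr_ge0// ltW.
have DS (a t : R) : 0 < a -> a <= c + 1 -> t <= S ->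
    forall x : 'rV[R]_n, radial_int K (enorm x) <= a * t + R1 -> enorm x < r.
  move=> a0 ac tS x Dx.
  have h1 : enorm x <= delta^-1 * (a * t + R1).
    rewrite ler_pdivlMl//; apply: le_trans Dx.
    by have := radial_int_ge cK KB (enorm_ge0 x).
  have h2 : a * t <= (c + 1) * S.
    apply: (@le_trans _ _ (a * S)); first by rewrite ler_pM2l.
    by rewrite ler_pM2r.
  have h3 : delta^-1 * (a * t + R1) <= delta^-1 * ((c + 1) * S + R1).
    by rewrite ler_pM2l// lerD2r.
  by apply: le_lt_trans h1 _; apply: le_lt_trans h3 _; rewrite /r -addrA ltrDl addr_gt0.
have TS t : 0 <= t -> t <= S -> time_interval T t.
  by move=> t0 tS; split => //; apply: le_lt_trans ST; rewrite lee_fin.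
have c1 : c <= c + 1 by rewrite lerDl.
have one1 : 1 <= c + 1 by rewrite lerDr ltW.
have hv1_phi' : 0 < vol_int g (fun x => (v1 x - 1 * lambda * v0 x) * phi x).
  by rewrite mul1r.
have [[U1 [U2 [dU dU1 U0 U10 EU]]] GU] :=
  wave_energy n0 d0 cK KB gsym gE gC q1 cp R10 c00 l0 eps0 S0 ST hphi equ
   (fun t x => powR_ge0 _ _) su (fun t Tt => (meas t Tt).1) (fun t Tt => (loc t Tt).1)
   (DS c S cp c1 (lexx S)) R0r hu0 hu1 hu0_ge0 hu1_ge0 hu0_supp hu1_supp hu0_phi hu1_phi.
have [[V1 [V2 [dV dV1 V0 V10 EV]]] GV] :=
  wave_energy n0 d0 cK KB gsym gE gC p1 ltr01 R10 c00 l0 eps0 S0 ST hphi eqv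
   (fun t x => powR_ge0 _ _) sv (fun t Tt => (meas t Tt).2) (fun t Tt => (loc t Tt).2)
   (DS 1 S ltr01 one1 (lexx S)) R0r hv0 hv1 hv0_ge0 hv1_ge0 hv0_supp hv1_supp hv0_phi hv1_phi'.
exists (fun t => pairing g (u t) (cutoff_mul r (fun=> 1))), U1, U2.
exists (fun t => pairing g (v t) (cutoff_mul r (fun=> 1))), V1, V2.
split => // t tS; have := tS; rewrite in_itv/= => /andP[/ltW t0 /ltW tS'].
- rewrite (EU t tS); have Tt := TS t t0 tS'.
  have [H1 H2] := HCv t r (v t) t0 (meas t Tt).2 (loc t Tt).2
    (ae_vanish_outside sv Tt) (DS 1 t ltr01 one1 tS').
  apply: (source_bounds Cv0 t0 eps0 hv0_phi p0 kv1 kv2 H1 _ (GV t t0 tS')).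
  apply: le_trans H2 _; rewrite le_eqVlt; apply/orP; left; apply/eqP.
  by congr (_ * expR _ * _); ring.
- rewrite (EV t tS); have Tt := TS t t0 tS'.
  have [H1 H2] := HCu t r (u t) t0 (meas t Tt).1 (loc t Tt).1
    (ae_vanish_outside su Tt) (DS c t cp c1 tS').
  apply: (source_bounds Cu0 t0 eps0 hu0_phi q0 ku1 ku2 H1 _ (GU t t0 tS')).
  apply: le_trans H2 _; rewrite le_eqVlt; apply/orP; left; apply/eqP.
  by congr (_ * expR _ * _); ring.
Qed.

(** [averaged_system] is symmetric in (u, p) and (v, q), and each order gives one of
the two terms of the maximum in [Gamma_SS]. *)
Lemma existence_time_bound : 0 < Gamma_SS p q n ->
  exists2 C, 0 < C & forall eps, 0 < eps -> eps < 1 ->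
  forall (T : \bar R) u v, weak_solution g K p q c R1 eps u0 u1 v0 v1 T u v ->
  (T <= (C * eps `^ (- (Gamma_SS p q n)^-1))%:E)%E.
Proof.
have [k k0 Hk] := averaged_system.
rewrite /Gamma_SS /Num.max; case: ifPn => _ G0.
- have [C C0 HC] := system_lifespan p1 q1 k0 G0.
  exists (2 * C); first by rewrite mulr_gt0.
  move=> eps eps0 eps1 T u v Hsol; rewrite leNgt; apply/negP.
  rewrite -mulrA => ST.
  have S0 : 0 < 2 * (C * eps `^ (- ((q + 2 + p^-1) / (p * q - 1) - (n%:R - 1) / 2)^-1)).
    by rewrite !mulr_gt0// powR_gt0.
  have [U [U1 [U2 [V [V1 [V2 [[d1 d2 d3 d4] [i1 i2 i3 i4] HU HV]]]]]]] :=
    Hk eps _ T u v eps0 S0 ST Hsol.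
  apply: (HC eps eps0 eps1 U U1 U2 V V1 V2) => // t tS.
  + exact: (HU t tS).1.
  + exact: (HU t tS).2.
  + exact: (HV t tS).2.
- rewrite [p * q]mulrC in G0 *.
  have [C C0 HC] := system_lifespan q1 p1 k0 G0.
  exists (2 * C); first by rewrite mulr_gt0.
  move=> eps eps0 eps1 T u v Hsol; rewrite leNgt; apply/negP.
  rewrite -mulrA => ST.
  have S0 : 0 < 2 * (C * eps `^ (- ((p + 2 + q^-1) / (q * p - 1) - (n%:R - 1) / 2)^-1)).
    by rewrite !mulr_gt0// powR_gt0.
  have [U [U1 [U2 [V [V1 [V2 [[d1 d2 d3 d4] [i1 i2 i3 i4] HU HV]]]]]]] :=
    Hk eps _ T u v eps0 S0 ST Hsol.
  apply: (HC eps eps0 eps1 V V1 V2 U U1 U2) => // t tS.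
  + exact: (HV t tS).1.
  + exact: (HV t tS).2.
  + exact: (HU t tS).2.
Qed.

End system.

Theorem theorem1p1 (R : realType) (n : nat) (p q c : R)
  (g : 'rV[R]_n -> 'M[R]_n) (K : R -> R)
  (lambda0 c0 lambda : R) (phi : 'rV[R]_n -> R)
  (u0 u1 v0 v1 : 'rV[R]_n -> R) (R0 R1 : R)
  (hn : (2 <= n)%N) (hp : 1 < p) (hq : 1 < q) (hc : 0 < c)
  (hGamma : 0 < Gamma_SS p q n)
  (hg : asymptotically_euclidean g K)
  (* lambda0 and c0 are as provided by the existence theory for phi_lambda *)
  (hlambda0 : 0 < lambda0) (hc0 : 0 < c0)
  (hfamily : forall l : R, 0 < l -> l <= lambda0 ->
     exists f, growing_eigenfunction g K c0 l f)
  (hlambda : 0 < lambda) (hlambda_le : lambda <= lambda0)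
  (hphi : growing_eigenfunction g K c0 lambda phi)
  (hu0 : test_function u0) (hu1 : test_function u1)
  (hv0 : test_function v0) (hv1 : test_function v1)
  (hu_nontrivial : exists x, u0 x != 0 \/ u1 x != 0)
  (hv_nontrivial : exists x, v0 x != 0 \/ v1 x != 0)
  (hu0_ge0 : forall x, 0 <= u0 x) (hu1_ge0 : forall x, 0 <= u1 x)
  (hv0_ge0 : forall x, 0 <= v0 x) (hv1_ge0 : forall x, 0 <= v1 x)
  (hR0 : 0 < R0)
  (hu0_supp : closed_support u0 `<=` [set x | enorm x <= R0])
  (hu1_supp : closed_support u1 `<=` [set x | enorm x <= R0])
  (hv0_supp : closed_support v0 `<=` [set x | enorm x <= R0])
  (hv1_supp : closed_support v1 `<=` [set x | enorm x <= R0])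
  (hu0_int : 0 < vol_int g u0) (hu1_int : 0 < vol_int g u1)
  (hu0_phi : 0 < vol_int g (fun x => u0 x * phi x))
  (hu1_phi : 0 < vol_int g (fun x => (u1 x - c * lambda * u0 x) * phi x))
  (hv0_int : 0 < vol_int g v0) (hv1_int : 0 < vol_int g v1)
  (hv0_phi : 0 < vol_int g (fun x => v0 x * phi x))
  (hv1_phi : 0 < vol_int g (fun x => (v1 x - lambda * v0 x) * phi x))
  (hR1 : radial_int K R0 <= R1) :
  exists eps0 : R, 0 < eps0 /\
  exists C : R, 0 < C /\
  forall eps : R, 0 < eps -> eps < eps0 ->
  forall (T : \bar R) (u v : R -> 'rV[R]_n -> R),
    weak_solution g K p q c R1 eps u0 u1 v0 v1 T u v ->
    let T_eps :=
      lifespan (weak_solution g K p q c R1 eps u0 u1 v0 v1) T u v in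
    (T_eps < +oo)%E /\ (T_eps <= (C * eps `^ (- (Gamma_SS p q n)^-1))%:E)%E.
Proof.
have n0 : (0 < n)%N by exact: ltn_trans hn.
have [C C0 HC] := existence_time_bound n0 hp hq hc hg hc0 hlambda hphi hu0 hu1 hv0 hv1
  hu0_ge0 hu1_ge0 hv0_ge0 hv1_ge0 hR0 hu0_supp hu1_supp hv0_supp hv1_supp
  hu0_phi hu1_phi hv0_phi hv1_phi hR1 hGamma.
exists 1; split; first exact: ltr01.
exists C; split => // eps eps0 eps1 T u v Hsol T_eps.
(* A continuation is itself a solution, so the bound on the existence time of all
solutions bounds the lifespan. *)
have H : (T_eps <= (C * eps `^ (- (Gamma_SS p q n)^-1))%:E)%E.
  apply: ge_ereal_sup => T' [_ [u' [v' [Hsol' _]]]].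
  exact: HC Hsol'.
by split => //; apply: le_lt_trans H _; rewrite ltry.
Qed.
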